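(* Let $K$ be a transition kernel on $(\Omega,\mathcal A)$ that is reversible with respect to the probability measure $\pi$ and lazy, and assume its conductance satisfies $\varphi(K,\pi)>0$. Let $\nu$ be a probability measure on $(\Omega,\mathcal A)$ having a bounded density $\frac{d\nu}{d\pi}$ with respect to $\pi$, and let $X_1,X_2,\dots$ be the Markov chain with transition kernel $K$ and initial distribution $\nu$. Let $f\in L_\infty(\Omega,\pi)$, $S(f)=\int_\Omega f(x)\,\pi(dx)$, and for integers $n\ge 1$, $n_0\ge 0$ let $S_{n,n_0}(f)=\frac1n\sum_{j=1}^n f(X_{n_0+j})$. Then $$e(S_{n,n_0},f)\le \frac{2\sqrt{1+24\sqrt{\left\Vert\frac{d\nu}{d\pi}\right\Vert_\infty}\,\exp\left[-n_0\frac{\varphi(K,\pi)^2}{2}\right]}}{\varphi(K,\pi)\cdot\sqrt n}\,\Vert f\Vert_\infty .$$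
   Context: $(\Omega,\mathcal A)$ is a countably generated measurable space. A transition kernel is a map $K:\Omega\times\mathcal A\to[0,1]$ such that $K(x,\cdot)$ is a probability measure for every $x\in\Omega$ and $K(\cdot,A)$ is $\mathcal A$-measurable for every $A\in\mathcal A$. $K$ is reversible with respect to $\pi$ if $\int_B K(x,A)\,\pi(dx)=\int_A K(x,B)\,\pi(dx)$ for all $A,B\in\mathcal A$ (so $\pi$ is stationary). $K$ is lazy if $K(x,\{x\})\ge 1/2$ for all $x\in\Omega$. The conductance is $$\varphi(K,\pi)=\inf_{0<\pi(A)\le 1/2}\frac{\int_A K(x,A^c)\,\pi(dx)}{\pi(A)},$$ the infimum being over $A\in\mathcal A$. Functions are real-valued and $\Vert\cdot\Vert_\infty$ is the norm of $L_\infty(\Omega,\pi)$. Convention for the chain: the starting point $X_0$ has distribution $\nu$ and $X_1,X_2,\dots$ are the subsequent states, so that $\mathbf E_{\nu,K}(f(X_i))=\int_\Omega P^i f(x)\,\nu(dx)$ and $\mathbf E_{\nu,K}(f(X_i)f(X_j))=\int_\Omega P^i\bigl(f\,P^{j-i}f\bigr)(x)\,\nu(dx)$ for $i\le j$, where $(Pf)(x)=\int_\Omega f(y)\,K(x,dy)$ and $\mathbf E_{\nu,K}$ denotes expectation for the chain with initial distribution $\nu$ and kernel $K$. The error is the root mean square error $e(S_{n,n_0},f)=\left(\mathbf E_{\nu,K}|S_{n,n_0}(f)-S(f)|^2\right)^{1/2}$. *)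

(* Defs.v *)
From mathcomp Require Import all_boot all_order all_algebra.
From mathcomp Require Import all_classical all_reals all_analysis.

Set Implicit Arguments.
Unset Strict Implicit.
Unset Printing Implicit Defensive.

Import Order.TTheory GRing.Theory Num.Theory.
Import numFieldNormedType.Exports.

Local Open Scope classical_set_scope.
Local Open Scope ring_scope.
Local Open Scope ereal_scope.

Definition countably_generated d (Omega : measurableType d) : Prop :=
  exists2 G : set (set Omega),
    countable G & (measurable : set (set Omega)) = <<s G >>.

Section kernels.
Context d (Omega : measurableType d) (R : realType).
Variables (K : R.-pker Omega ~> Omega) (pi : probability Omega R).

Definition reversible : Prop :=
  forall A B, measurable A -> measurable B ->
    \int[pi]_(x in B) K x A = \int[pi]_(x in A) K x B.

(* Measures are total functions on [set Omega], with unconstrained values on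
   non-measurable sets. The value of [K x] at a singleton is thus meaningful
   only if that singleton is measurable, which is therefore required. *)
Definition lazy : Prop :=
  forall x, measurable [set x] /\ (2^-1)%:E <= K x [set x].

(* If no measurable set has measure in ]0, 1/2], the infimum is +oo. *)
Definition conductance : \bar R :=
  ereal_inf [set (\int[pi]_(x in A) K x (~` A)) / pi A |
             A in [set A | measurable A /\ 0 < pi A <= (2^-1)%:E]].

End kernels.

Section chains.
Context d (Omega : measurableType d) (R : realType).
Context d' (T : measurableType d') (P : probability T R).
Implicit Types X : nat -> {RV P >-> Omega}.

(* The Markov property says that the conditional distribution of X_(n+1) given
   the sigma-algebra generated by X_0, ..., X_n is K(X_n, .). *)
Definition markov_chain (nu : probability Omega R) (K : R.-pker Omega ~> Omega)
    X : Prop :=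
  (forall A, measurable A -> distribution P (X 0%N) A = nu A) /\
  (forall n E A,
     g_sigma_preimage (fun i : 'I_n.+1 => X i : T -> Omega) E ->
     measurable A ->
     P (E `&` X n.+1 @^-1` A) = \int[P]_(w in E) K (X n w) A).

Definition sample_mean X (f : Omega -> R) (n n0 : nat) (w : T) : R :=
  (n%:R^-1 * \sum_(1 <= j < n.+1) f (X (n0 + j)%N w))%R.

Definition rmse (Y : T -> R) (s : R) : \bar R :=
  'E_P[fun w => (`|Y w - s| ^+ 2)%R] `^ 2^-1.

End chains.

(* Main.v *)
Require Import Defs.
From mathcomp Require Import all_boot all_order all_algebra.
From mathcomp Require Import all_classical all_reals all_analysis.
From mathcomp Require Import measurable_realfun ess_sup_inf.
From mathcomp Require Import ring lra.

Set Implicit Arguments.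
Unset Strict Implicit.
Unset Printing Implicit Defensive.

Import Order.TTheory GRing.Theory Num.Theory.
Import numFieldNormedType.Exports.

Local Open Scope classical_set_scope.
Local Open Scope ring_scope.

(** Write P for the Markov operator (P u)(x) = int u(y) K(x, dy), let rho be the
    density of nu, g = f - S(f), c = phi(K, pi), and |u| for the norm of u in
    L2(pi).  The square of the error is the average of E g(X_i') g(X_j') over the
    pairs i' = n0 + i, j' = n0 + j with 1 <= i, j <= n, and the Markov property
    turns each of these, for i' <= j', into the scalar product
      <rho, P^i' (g . P^(j'-i') g)>   in L2(pi).
    Replacing rho by 1 + (rho - 1) and moving P^i' to the left factor by
    reversibility, everything reduces to one fact: P contracts the mean-zero
    functions of L2(pi) by the factor b = 1 - c^2/2.  Indeed the absolute value
    of the scalar product is then at most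
      b^(j'-i') (|g|^2 + |rho - 1| b^i' sup|g| |g|)
    ([correlation_le]), where |g| <= F and sup|g| <= 2F, with F the essential
    supremum of the absolute value of f, and |rho - 1| <= sqrt(sup rho).  Since b^|i-j| sums to at most 2/(1-b) = 4/c^2
    along a row, the mean square error is at most
      4/(c^2 n) F^2 (1 + 2 sqrt(sup rho) exp(-n0 c^2/2)),
    which is the announced bound with 2 in place of 24.

    The contraction comes from two bounds on <g, P g>.  Cheeger's inequality
    ([cheeger]) gives <g, P g> <= b |g|^2 for mean-zero g; laziness gives <g, P g> >= 0
    ([ip_mop_ge0]); and the Cauchy-Schwarz inequality for the nonnegative form
    <u, P v>, applied to P g and g, then yields |P g| <= b |g| ([nrm_mop_le]).
    Cheeger's inequality itself is proved for nonnegative functions supported on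
    a set of measure at most 1/2, by applying the conductance to the superlevel
    sets of g^2 and summing, and extended to all g by cutting at a median.

    All functions are kept bounded everywhere: f and rho are replaced by bounded
    versions equal to them pi-almost everywhere, which is harmless because every
    X_j has a law dominated by pi.  When the conductance is infinite, the real
    number c may be chosen with c^2 > 2; then b < 0 and the two bounds on <g, P g>
    force g = 0 almost everywhere, so that the error vanishes. *)

(** * Bounded measurable functions *)

Section bounded_measurable.
Context d (T : measurableType d) (R : realType).
Implicit Types (f g h : T -> R) (A : set T).

(** Bounds are required everywhere, not almost everywhere: such functions are
    integrable for all the measures [K x], for pi, and for the law of the chain
    alike, and they are stable under the Markov operator. *)
Definition bmeas f : Prop :=
  measurable_fun setT f /\ exists C, forall x, `|f x| <= C.

Lemma bmeas_cst (c : R) : bmeas (fun=> c).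
Proof. by split; [exact: measurable_cst|exists `|c|]. Qed.

Lemma bmeasD f g : bmeas f -> bmeas g -> bmeas (fun x => f x + g x).
Proof.
move=> [mf [C fC]] [mg [D gD]]; split; first exact: measurable_funD.
by exists (C + D) => x; rewrite (le_trans (ler_normD _ _))// lerD.
Qed.

Lemma bmeasN f : bmeas f -> bmeas (fun x => - f x).
Proof.
move=> [mf [C fC]]; split; first exact: measurableT_comp.
by exists C => x; rewrite normrN.
Qed.

Lemma bmeasM f g : bmeas f -> bmeas g -> bmeas (fun x => f x * g x).
Proof.
move=> [mf [C fC]] [mg [D gD]]; split; first exact: measurable_funM.
by exists (C * D) => x; rewrite normrM ler_pM.
Qed.

Lemma bmeasX f n : bmeas f -> bmeas (fun x => f x ^+ n).
Proof.
move=> bf; elim: n => [|n IH]; first exact: bmeas_cst.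
by rewrite (_ : (fun _ => _) = (fun x => f x * f x ^+ n));
  [exact: bmeasM|apply/funext => x; rewrite exprS].
Qed.

Lemma bmeas_max f g : bmeas f -> bmeas g -> bmeas (fun x => Num.max (f x) (g x)).
Proof.
move=> [mf [C fC]] [mg [D gD]]; split; first exact: measurable_maxr.
by exists (Num.max C D) => x; case: (leP (f x) (g x)) => _;
  rewrite le_max ?fC ?gD ?orbT.
Qed.

Lemma bmeas_indic A : measurable A -> bmeas (\1_A : T -> R).
Proof.
move=> mA; split; first exact: measurable_indic.
by exists 1 => x; rewrite indicE; case: (_ \in _); rewrite ?normr1 ?normr0.
Qed.

Lemma bmeas_sum I (r : seq I) (F : I -> T -> R) :
  (forall i, bmeas (F i)) -> bmeas (fun x => \sum_(i <- r) F i x).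
Proof.
move=> bF; elim: r => [|i r IH].
  by under eq_fun do rewrite big_nil; exact: bmeas_cst.
by under eq_fun do rewrite big_cons; exact: bmeasD.
Qed.

End bounded_measurable.

Lemma bmeas_comp d d' (T : measurableType d) (U : measurableType d')
    (R : realType) (X : U -> T) (f : T -> R) :
  measurable_fun setT X -> bmeas f -> bmeas (fun u => f (X u)).
Proof.
move=> mX [mf [C fC]]; split; first exact: (measurableT_comp mf mX).
by exists C => u.
Qed.

Ltac bmeas_step := first
  [ assumption | done | apply: bmeas_cst | apply: bmeasD | apply: bmeasN
  | apply: bmeasM | apply: bmeasX | apply: bmeas_max
  | apply: bmeas_indic ].
Ltac solve_bmeas := repeat bmeas_step.

Section expectations.
Context d (T : measurableType d) (R : realType).
Variable mu : {measure set T -> \bar R}.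
Hypothesis mu1 : mu setT = 1%E.
Implicit Types (f g h : T -> R) (A : set T).

Lemma bmeas_integrable f : bmeas f -> mu.-integrable setT (EFin \o f).
Proof.
move=> [mf [C fC]]; apply: measurable_bounded_integrable => //.
  by rewrite mu1 ltry.
exists C; split; first exact: num_real.
by move=> M CM x _; exact: le_trans (fC x) (ltW CM).
Qed.

Lemma EFin_Rintegral f : bmeas f -> (\int[mu]_x f x)%:E = (\int[mu]_x (f x)%:E)%E.
Proof.
by move=> bf; rewrite /Rintegral fineK//; exact/integrable_fin_num/bmeas_integrable.
Qed.

Lemma RintD f g : bmeas f -> bmeas g ->
  \int[mu]_x (f x + g x) = \int[mu]_x f x + \int[mu]_x g x.
Proof. by move=> bf bg; rewrite RintegralD//; exact: bmeas_integrable. Qed.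

Lemma RintZ c f : bmeas f -> \int[mu]_x (c * f x) = c * \int[mu]_x f x.
Proof. by move=> bf; rewrite RintegralZl//; exact: bmeas_integrable. Qed.

Lemma Rint_cst c : \int[mu]_x c = c.
Proof. by rewrite Rintegral_cst// mu1 mulr1. Qed.

Lemma le_Rint f g : bmeas f -> bmeas g -> (forall x, f x <= g x) ->
  \int[mu]_x f x <= \int[mu]_x g x.
Proof. by move=> bf bg fg; apply: le_Rintegral => //; exact: bmeas_integrable. Qed.

Lemma Rint_ge0 f : (forall x, 0 <= f x) -> 0 <= \int[mu]_x f x.
Proof. by move=> f0; apply: Rintegral_ge0. Qed.

Lemma Rint_indic A : measurable A -> \int[mu]_x \1_A x = fine (mu A).
Proof. by move=> mA; rewrite /Rintegral integral_indic// setIT. Qed.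

Lemma Rint_sum I (r : seq I) (F : I -> T -> R) : (forall i, bmeas (F i)) ->
  \int[mu]_x (\sum_(i <- r) F i x) = \sum_(i <- r) \int[mu]_x F i x.
Proof.
move=> bF; elim: r => [|i r IH].
  by under eq_Rintegral do rewrite big_nil; rewrite Rint_cst big_nil.
rewrite big_cons -IH -RintD//; last exact: bmeas_sum.
by apply: eq_Rintegral => x _; rewrite big_cons.
Qed.

Lemma ler_norm_Rint f C : bmeas f -> (forall x, `|f x| <= C) ->
  `|\int[mu]_x f x| <= C.
Proof.
move=> bf fC; rewrite ler_norml; apply/andP; split.
  rewrite -(Rint_cst (- C)) le_Rint//; solve_bmeas.
  by move=> x; have := fC x; rewrite ler_norml => /andP[].
rewrite -(Rint_cst C) le_Rint//; solve_bmeas.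
by move=> x; have := fC x; rewrite ler_norml => /andP[].
Qed.

End expectations.

Section staircase.
Variable R : realType.
Implicit Types v w : R.

(** The integer part of a nonnegative [v], capped at [m], written as a sum of
    indicators of superlevel sets so that linear functionals pass through it. *)
Definition stairs m v : R := \sum_(1 <= k < m.+1) (k%:R <= v)%R%:R.

Lemma stairsS m v : stairs m.+1 v = stairs m v + (m.+1%:R <= v)%R%:R.
Proof. by rewrite /stairs big_nat_recr. Qed.

Lemma stairs0 v : stairs 0 v = 0.
Proof. by rewrite /stairs big_geq. Qed.

Lemma stairs_full m v : m%:R <= v -> stairs m v = m%:R.
Proof.
elim: m => [|m IH] mv; first by rewrite stairs0.
rewrite stairsS mv IH ?natr1//; apply: le_trans mv.
by rewrite ler_nat.
Qed.

Lemma stairs_le m v : 0 <= v -> stairs m v <= v.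
Proof.
move=> v0; elim: m => [|m IH]; first by rewrite stairs0.
have [mv|mv] := leP m.+1%:R v; first by rewrite stairs_full.
by rewrite stairsS (lt_geF mv) mulr0n addr0.
Qed.

Lemma stairs_ge m v : v <= m%:R -> v - 1 <= stairs m v.
Proof.
elim: m => [|m IH] mv; first by rewrite stairs0; lra.
rewrite stairsS; have [vm|mv'] := leP v m%:R.
  by rewrite (le_trans (IH vm))// lerDl.
rewrite stairs_full ?(ltW mv')//; apply: (@le_trans _ _ m%:R); last by rewrite lerDl.
by rewrite -natr1 in mv; lra.
Qed.

(** The sum counts the integers k with w < k <= v, of which an interval of
    length v - w contains at most v - w + 1. *)
Lemma stairs_cross m v w : 0 <= v -> w <= m%:R ->
  \sum_(1 <= k < m.+1) (k%:R <= v)%R%:R * (1 - (k%:R <= w)%R%:R)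
    <= Num.max 0 (v - w) + 1.
Proof.
move=> v0 wm; have [vw|wv] := leP v w.
  rewrite big1_seq ?addr_ge0 ?le_max ?lexx// => k _.
  have [kv|] := leP k%:R v; last by rewrite mul0r.
  by rewrite (le_trans kv vw) subrr mulr0.
rewrite (_ : \sum_(_ <= _ < _) _ = stairs m v - stairs m w).
  have := stairs_le m v0; have := stairs_ge wm.
  suff : v - w <= Num.max 0 (v - w) by lra.
  by rewrite le_max lexx orbT.
rewrite /stairs -sumrB; apply: eq_bigr => k _.
have [kw|wk] := leP k%:R w; first by rewrite (le_trans kw (ltW wv)) subrr mulr0.
by rewrite subr0 mulr1 subr0.
Qed.

End staircase.

Section bounded_measurable_induction.
Context d (T : measurableType d) (R : realType).

(** The staircase of mesh 1/N under f is a linear combination of indicators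
    within 1/N of f, uniformly. *)
Lemma bmeas_ind (S : (T -> R) -> Prop) :
  (forall A, measurable A -> S \1_A) ->
  (forall c f g, bmeas f -> bmeas g -> S f -> S g ->
    S (fun x => c * f x + g x)) ->
  (forall f, bmeas f ->
    (forall e : R, 0 < e -> exists g, [/\ bmeas g, S g &
      forall x, `|f x - g x| <= e]) -> S f) ->
  forall f, bmeas f -> S f.
Proof.
move=> Sind Slin Sunif f bf; apply: (Sunif) => // e e0.
have [mf [C fC]] := bf.
pose N := (Num.truncn (e^-1)).+1.
have N0 : 0 < N%:R :> R by rewrite ltr0n.
have Ne : N%:R^-1 <= e.
  by rewrite -(invrK e) lef_pV2 ?posrE ?invr_gt0// ltW// truncnS_gt.
(* f + C takes its values in the interval [0, 2 C]. *)
pose m := (Num.truncn (2 * (C * N%:R))).+1.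
pose A k := [set x | k%:R <= N%:R * (f x + C)].
have mA k : measurable (A k).
  rewrite (_ : A k = setT `&` (fun x => N%:R * (f x + C)) @^-1` `[k%:R, +oo[).
    have [mg _] : bmeas (fun x => N%:R * (f x + C)) by solve_bmeas.
    by apply: mg => //; exact: measurable_itv.
  by rewrite setTI; apply/seteqP; split => x /=; rewrite in_itv/= andbT.
have S0 : S (fun=> 0).
  rewrite (_ : (fun=> 0) = \1_set0); first exact: Sind.
  by apply/funext => x; rewrite indic0.
have Scst c : S (fun=> c).
  rewrite (_ : (fun=> c) = (fun x => c * \1_(setT : set T) x + 0)).
    by apply: Slin; [solve_bmeas..|exact: Sind|].
  by apply/funext => x; rewrite indicT mulr1 addr0.
have bst m' : bmeas (fun x => stairs m' (N%:R * (f x + C))) /\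
              S (fun x => stairs m' (N%:R * (f x + C))).
  elim: m' => [|m' [bIH SIH]]; first by under eq_fun do rewrite stairs0; split; solve_bmeas.
  rewrite (_ : (fun _ => _) = fun x => 1 * \1_(A m'.+1) x +
      stairs m' (N%:R * (f x + C))).
    by split; [solve_bmeas; exact: mA|apply: Slin => //; [solve_bmeas; exact: mA|exact: Sind]].
  apply/funext => x; rewrite stairsS addrC mul1r indicE; congr (_ + _).
  by congr (_%:R); congr nat_of_bool; apply/idP/idP; rewrite inE.
exists (fun x => N%:R^-1 * stairs m (N%:R * (f x + C)) + - C); split.
- by have [? _] := bst m; solve_bmeas.
- by apply: Slin; [by have [] := bst m|solve_bmeas|by have [] := bst m|].
- move=> x; apply: le_trans Ne.
  have := fC x; rewrite ler_norml => /andP[fl fr].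
  have v0 : 0 <= N%:R * (f x + C) by apply: mulr_ge0; [exact: ltW|lra].
  have vm : N%:R * (f x + C) <= m%:R.
    apply: le_trans (ltW (truncnS_gt _)).
    rewrite (_ : 2 * (C * N%:R) = N%:R * (C + C)); last by ring.
    by apply: ler_wpM2l; [exact: ltW|lra].
  have -> : f x - (N%:R^-1 * stairs m (N%:R * (f x + C)) + - C) =
     N%:R^-1 * (N%:R * (f x + C) - stairs m (N%:R * (f x + C))).
    by rewrite mulrBr mulKf ?gt_eqF//; lra.
  have := stairs_le m v0; have := stairs_ge vm => ? ?.
  have iN : 0 <= N%:R^-1 :> R by rewrite invr_ge0 ler0n.
  rewrite -[leRHS]mulr1 normrM (ger0_norm iN).
  by apply: ler_wpM2l => //; rewrite ler_norml; lra.
Qed.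

Definition bounded_linear (Phi : (T -> R) -> R) : Prop :=
  (forall c f g, bmeas f -> bmeas g ->
    Phi (fun x => c * f x + g x) = c * Phi f + Phi g) /\
  exists C, forall f e, bmeas f -> (forall x, `|f x| <= e) -> `|Phi f| <= C * e.

(** This plays the role of a uniqueness theorem for measures: it extends
    identities known for indicators, such as reversibility or the Markov
    property, to functions.  Bilinear identities are extended in one variable at a
    time. *)
Lemma bounded_linear_ext (Phi Psi : (T -> R) -> R) :
  bounded_linear Phi -> bounded_linear Psi ->
  (forall A, measurable A -> Phi \1_A = Psi \1_A) ->
  forall f, bmeas f -> Phi f = Psi f.
Proof.
move=> [linP [C PC]] [linQ [D QD]] PQ; apply: bmeas_ind => //.
  by move=> c f g bf bg PQf PQg; rewrite linP// linQ// PQf PQg.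
move=> f bf fapp; apply/eqP; rewrite -subr_eq0 -normr_le0.
have M0 : 0 < `|C + D| + 1 by rewrite ltr_wpDl.
apply/ler_addgt0Pr => e e0; rewrite add0r.
have [|g [bg PQg fg]] := fapp (e / (`|C + D| + 1)); first exact: divr_gt0.
have bfg : bmeas (fun x => f x - g x) by solve_bmeas.
have Pe (L : (T -> R) -> R) : (forall c f g, bmeas f -> bmeas g ->
    L (fun x => c * f x + g x) = c * L f + L g) -> L f = L (fun x => f x - g x) + L g.
  move=> linL; rewrite -[X in X + _]mul1r -linL//; congr L; apply/funext => x.
  by ring.
rewrite (Pe Phi)// (Pe Psi)// PQg.
rewrite (_ : _ - _ = Phi (fun x => f x - g x) - Psi (fun x => f x - g x)); last by ring.
apply: (le_trans (ler_normB _ _)).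
apply: (le_trans (lerD (PC _ _ bfg fg) (QD _ _ bfg fg))).
rewrite -mulrDl mulrCA ger_pMr// ler_pdivrMr// mul1r.
by rewrite (le_trans (ler_norm _))// lerDl.
Qed.

End bounded_measurable_induction.

(** * The Markov operator of a reversible kernel *)

(** Behind both Cauchy-Schwarz inequalities used below, the one for the scalar
    product of L2 and the one for the form <u, P v>. *)
Lemma discriminant_le (R : realFieldType) (a b c : R) :
  0 <= c -> (forall t, 0 <= a - 2 * t * b + t ^+ 2 * c) -> b ^+ 2 <= a * c.
Proof.
rewrite le_eqVlt => /predU1P[<- H|c0 H].
  have [->|b0] := eqVneq b 0; first by rewrite mulr0 expr0n.
  have := H ((a + 1) / (2 * b)).
  rewrite (_ : _ - _ + _ = - 1); last by field.
  by rewrite ler0N1.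
have := H (b / c); rewrite (_ : _ - _ + _ = (a * c - b ^+ 2) / c).
  by rewrite pmulr_lge0 ?invr_gt0// subr_ge0.
by field; rewrite gt_eqF.
Qed.

Section inner_product.
Context d (T : measurableType d) (R : realType).
Variable mu : {measure set T -> \bar R}.
Hypothesis mu1 : mu setT = 1%E.
Implicit Types (f g h u v w : T -> R).

Definition ip f g : R := \int[mu]_x (f x * g x).
Definition nrm f : R := Num.sqrt (ip f f).

Lemma ipC f g : ip f g = ip g f.
Proof. by apply: eq_Rintegral => x _; rewrite mulrC. Qed.

Lemma ipl a u v w : bmeas u -> bmeas v -> bmeas w ->
  ip (fun x => a * u x + v x) w = a * ip u w + ip v w.
Proof.
move=> bu bv bw; rewrite /ip -RintZ//; solve_bmeas; rewrite -RintD//; solve_bmeas.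
by apply: eq_Rintegral => x _; ring.
Qed.

Lemma ipr a u v w : bmeas u -> bmeas v -> bmeas w ->
  ip w (fun x => a * u x + v x) = a * ip w u + ip w v.
Proof. by move=> bu bv bw; rewrite ipC ipl// ipC (ipC v). Qed.

Lemma ip_ge0 u : 0 <= ip u u.
Proof. by apply: Rint_ge0 => x; rewrite -expr2 sqr_ge0. Qed.

Lemma nrm_ge0 u : 0 <= nrm u. Proof. exact: sqrtr_ge0. Qed.

Lemma nrm_sqr u : nrm u ^+ 2 = ip u u. Proof. by rewrite sqr_sqrtr ?ip_ge0. Qed.

Lemma ip_le u v : bmeas u -> bmeas v -> ip u v ^+ 2 <= ip u u * ip v v.
Proof.
move=> bu bv; apply: discriminant_le => [|t]; first exact: ip_ge0.
have := ip_ge0 (fun x => - t * v x + u x).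
by rewrite ipl ?ipr ?(ipC v u)//; solve_bmeas; lra.
Qed.

Lemma norm_ip_le u v : bmeas u -> bmeas v -> `|ip u v| <= nrm u * nrm v.
Proof.
move=> bu bv; rewrite -(@ler_pXn2r _ 2)// ?nnegrE ?mulr_ge0 ?nrm_ge0//.
by rewrite real_normK ?num_real// exprMn !nrm_sqr; exact: ip_le.
Qed.

Lemma nrm_le u C : bmeas u -> 0 <= C -> ip u u <= C ^+ 2 -> nrm u <= C.
Proof. by move=> bu C0 uC; rewrite /nrm -(ger0_norm C0) -sqrtr_sqr ler_wsqrtr. Qed.

End inner_product.

Section markov_operator.
Context d (T : measurableType d) (R : realType).
Variable K : R.-pker T ~> T.
Implicit Types (f g h : T -> R) (A B : set T).

(** Written P in the comments. *)
Definition mop f : T -> R := fun x => \int[K x]_y f y.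

Let K1 x : K x setT = 1%E. Proof. exact: prob_kernel. Qed.

Lemma mopl c f g : bmeas f -> bmeas g ->
  mop (fun y => c * f y + g y) = fun x => c * mop f x + mop g x.
Proof.
move=> bf bg; apply/funext => x; rewrite /mop RintD//; first by rewrite RintZ.
by solve_bmeas.
Qed.

Lemma mop_cst c : mop (fun=> c) = fun=> c.
Proof. by apply/funext => x; rewrite /mop Rint_cst. Qed.

Lemma mop_ge0 f : (forall y, 0 <= f y) -> forall x, 0 <= mop f x.
Proof. by move=> f0 x; exact: Rint_ge0. Qed.

Lemma mop_indic A x : measurable A -> mop \1_A x = fine (K x A).
Proof. exact: Rint_indic. Qed.

Lemma mop_norm f C : bmeas f -> (forall y, `|f y| <= C) -> forall x, `|mop f x| <= C.
Proof. by move=> bf fC x; exact: ler_norm_Rint. Qed.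

(** Shifting f by its bound makes it nonnegative, and the integral of a
    nonnegative function is a measurable function of the point x. *)
Lemma bmeas_mop f : bmeas f -> bmeas (mop f).
Proof.
move=> bf; have [mf [C fC]] := bf.
split; last by exists C; exact: mop_norm.
have -> : mop f = fun x => 1 * mop (fun y => 1 * f y + C) x + - C.
  by apply/funext => x; rewrite mopl//; solve_bmeas; rewrite mop_cst; ring.
apply: measurable_funD => //; apply: measurable_funM => //.
apply: (measurableT_comp (@fine_measurable _ _ measurableT)).
apply: measurable_fun_integral_kernel.
- by move=> U mU; exact: measurable_kernel.
- by move=> y; rewrite lee_fin; have := fC y; rewrite ler_norml => /andP[]; lra.
- by apply/measurable_EFinP; have [] : bmeas (fun y => 1 * f y + C) by solve_bmeas.
Qed.

Lemma bmeas_iter_mop i f : bmeas f -> bmeas (iter i mop f).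
Proof. by move=> bf; elim: i => //= i; exact: bmeas_mop. Qed.

Variable pi : probability T R.
Let pi1 : pi setT = 1%E. Proof. exact: probability_setT. Qed.

Lemma ip_indic A B : measurable A -> measurable B ->
  (ip pi \1_B (mop \1_A))%:E = (\int[pi]_(x in B) K x A)%E.
Proof.
move=> mA mB; rewrite EFin_Rintegral//; last first.
  by solve_bmeas => //; apply: bmeas_mop; solve_bmeas.
rewrite [RHS]integral_mkcond; apply: eq_integral => x _.
rewrite mop_indic// patchE indicE; case: (x \in B); last by rewrite mul0r.
rewrite mul1r fineK// ge0_fin_numE// (@le_lt_trans _ _ 1%E) ?ltry// -(K1 x).
by apply: le_measure => //; rewrite inE.
Qed.

Hypothesis rev : reversible K pi.

(** Reversibility is this identity for indicators; both sides are bounded linear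
    functionals of each argument. *)
Lemma mop_sym f g : bmeas f -> bmeas g -> ip pi f (mop g) = ip pi g (mop f).
Proof.
move=> bf bg.
apply: (bounded_linear_ext (Phi := fun u => ip pi f (mop u))
  (Psi := fun u => ip pi u (mop f))) bg.
- split=> [c u v bu bv|]; first by rewrite mopl// ipr//; exact: bmeas_mop.
  have [mf [C fC]] := bf.
  exists C => u e bu ue; apply: ler_norm_Rint => // [|x].
    by solve_bmeas; exact: bmeas_mop.
  by rewrite normrM ler_pM// mop_norm.
- split=> [c u v bu bv|]; first by rewrite ipl//; exact: bmeas_mop.
  have [mf [C fC]] := bmeas_mop bf.
  exists C => u e bu ue; apply: ler_norm_Rint => // [|x].
    by solve_bmeas; exact: bmeas_mop.
  by rewrite normrM mulrC ler_pM.
move=> A mA; apply: (bounded_linear_ext (Phi := fun u => ip pi u (mop \1_A))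
  (Psi := fun u => ip pi \1_A (mop u))) bf.
- split=> [c u v bu bv|]; first by rewrite ipl//; apply: bmeas_mop; solve_bmeas.
  have [m [C fC]] := bmeas_mop (bmeas_indic R mA).
  exists C => u e bu ue; apply: ler_norm_Rint => // [|x].
    by solve_bmeas => //; apply: bmeas_mop; solve_bmeas.
  by rewrite normrM mulrC ler_pM.
- split=> [c u v bu bv|]; first by rewrite mopl// ipr//; solve_bmeas => //; exact: bmeas_mop.
  exists 1 => u e bu ue; apply: ler_norm_Rint => // [|x].
    by solve_bmeas => //; apply: bmeas_mop; solve_bmeas.
  rewrite normrM ler_pM ?mop_norm// indicE.
  by case: (_ \in _); rewrite ?normr1 ?normr0.
move=> B mB; by apply: EFin_inj; rewrite (ip_indic mA mB) (ip_indic mB mA) rev.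
Qed.

Lemma mop_stationary f : bmeas f -> \int[pi]_x mop f x = \int[pi]_x f x.
Proof.
move=> bf; have := mop_sym (bmeas_cst T 1) bf; rewrite /ip mop_cst.
by under eq_Rintegral do rewrite mul1r; move=> ->; apply: eq_Rintegral => x _;
  rewrite mulr1.
Qed.

End markov_operator.

(** * Expectations of two consecutive states *)

Section joint_expectation.
Context d (T : measurableType d) (R : realType).
Variables (K : R.-pker T ~> T) (pi : probability T R).
Implicit Types (f g h : T -> R) (J : T -> T -> R).
Let pi1 : pi setT = 1%E. Proof. exact: probability_setT. Qed.
Let K1 x : K x setT = 1%E. Proof. exact: prob_kernel. Qed.

(** The expectation of J(X_0, X_1) when X_0 has law pi.  As an iterated integral
    it is linear and monotone on the class [jmeas], which contains all products
    f(x) h(y), by integrating in one variable at a time. *)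
Definition joint J : R := \int[pi]_x mop K (J x) x.

Definition jmeas J : Prop :=
  (forall x, bmeas (J x)) /\ bmeas (fun x => mop K (J x) x).

Lemma le_joint J J' : jmeas J -> jmeas J' -> (forall x y, J x y <= J' x y) ->
  joint J <= joint J'.
Proof.
move=> [bJ mJ] [bJ' mJ'] JJ'; apply: le_Rint => // x; exact: le_Rint.
Qed.

Let mopM f h x : bmeas h -> mop K (fun y => f x * h y) x = f x * mop K h x.
Proof. by move=> bh; rewrite /mop RintZ. Qed.

Lemma jmeasM f h : bmeas f -> bmeas h -> jmeas (fun x y => f x * h y).
Proof.
move=> bf bh; split=> [x|]; first by solve_bmeas.
by under eq_fun do rewrite mopM//; solve_bmeas; exact: bmeas_mop.
Qed.

Lemma jointM f h : bmeas f -> bmeas h ->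
  joint (fun x y => f x * h y) = ip pi f (mop K h).
Proof. by move=> bf bh; apply: eq_Rintegral => x _; rewrite mopM. Qed.

Let mopD J J' x : jmeas J -> jmeas J' ->
  mop K (fun y => J x y + J' x y) x = mop K (J x) x + mop K (J' x) x.
Proof. by move=> [bJ _] [bJ' _]; rewrite /mop RintD. Qed.

Lemma jmeasD J J' : jmeas J -> jmeas J' -> jmeas (fun x y => J x y + J' x y).
Proof.
move=> mJ mJ'; split=> [x|]; first by solve_bmeas; [apply mJ|apply mJ'].
by under eq_fun do rewrite mopD//; solve_bmeas; [apply mJ|apply mJ'].
Qed.

Lemma jointD J J' : jmeas J -> jmeas J' ->
  joint (fun x y => J x y + J' x y) = joint J + joint J'.
Proof.
move=> mJ mJ'; rewrite /joint -RintD//; [|by apply mJ|by apply mJ'].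
by apply: eq_Rintegral => x _; rewrite mopD.
Qed.

Lemma joint_sum I (r : seq I) (J : I -> T -> T -> R) : (forall i, jmeas (J i)) ->
  jmeas (fun x y => \sum_(i <- r) J i x y) /\
  joint (fun x y => \sum_(i <- r) J i x y) = \sum_(i <- r) joint (J i).
Proof.
move=> mJ; elim: r => [|i r [mr Er]].
  rewrite (_ : (fun _ => _) = fun=> fun=> 0 * 0); last first.
    by apply/funext => x; apply/funext => y; rewrite big_nil mul0r.
  split; first by apply: jmeasM; solve_bmeas.
  rewrite jointM; solve_bmeas; rewrite /ip big_nil.
  by under eq_Rintegral do rewrite mul0r; rewrite Rint_cst.
rewrite (_ : (fun _ => _) = fun x y => J i x y + \sum_(i <- r) J i x y).
  by split; [exact: jmeasD|rewrite jointD// Er big_cons].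
by apply/funext => x; apply/funext => y; rewrite big_cons.
Qed.

Hypothesis rev : reversible K pi.

(** By stationarity both g(x)^2 and g(y)^2 have expectation |g|^2, so a pointwise
    inequality between quadratic forms in (g x, g y) integrates to a linear
    inequality between |g|^2 and <g, P g>. *)
Lemma joint_quadratic g a b e k : bmeas g ->
  let J := fun x y => a * g x ^+ 2 + b * g y ^+ 2 + e * (g x * g y) + k in
  jmeas J /\ joint J = (a + b) * ip pi g g + e * ip pi g (mop K g) + k.
Proof.
move=> bg J.
have EJ : J = (fun x y => ((a * g x ^+ 2) * 1 + 1 * (b * g y ^+ 2)) +
     (e * g x) * g y + k * 1).
  by apply/funext => x; apply/funext => y; rewrite /J; ring.
have m1 : jmeas (fun x y => (a * g x ^+ 2) * 1) by apply: jmeasM; solve_bmeas.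
have m2 : jmeas (fun x y => 1 * (b * g y ^+ 2)) by apply: jmeasM; solve_bmeas.
have m3 : jmeas (fun x y => (e * g x) * g y) by apply: jmeasM; solve_bmeas.
have m4 : jmeas (fun x y : T => k * 1) by apply: jmeasM; solve_bmeas.
rewrite EJ; split; first by do !apply: jmeasD.
have bP := bmeas_mop K bg.
rewrite !jointD//; [|by do !apply: jmeasD..].
rewrite (jointM (f := fun x => a * g x ^+ 2) (h := fun=> 1)); solve_bmeas.
rewrite (jointM (f := fun=> 1) (h := fun y => b * g y ^+ 2)); solve_bmeas.
rewrite (jointM (f := fun x => e * g x)); solve_bmeas.
rewrite (jointM (f := fun=> k) (h := fun=> 1)); solve_bmeas.
rewrite !mop_cst /ip Rint_cst// mulr1.
under [X in _ + X + _ + _]eq_Rintegral do rewrite mul1r.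
rewrite mop_stationary//; solve_bmeas.
have -> : \int[pi]_x (a * g x ^+ 2 * 1) = a * \int[pi]_x (g x * g x).
  by rewrite -RintZ//; solve_bmeas; apply: eq_Rintegral => x _; ring.
have -> : \int[pi]_x (b * g x ^+ 2) = b * \int[pi]_x (g x * g x).
  by rewrite -RintZ//; solve_bmeas; apply: eq_Rintegral => x _; ring.
have -> : \int[pi]_x (e * g x * mop K g x) = e * \int[pi]_x (g x * mop K g x).
  by rewrite -RintZ//; solve_bmeas; apply: eq_Rintegral => x _; ring.
by ring.
Qed.

(** Integrate 0 <= (g x - g y)^2. *)
Lemma ip_mop_le g : bmeas g -> ip pi g (mop K g) <= ip pi g g.
Proof.
move=> bg; have [m E] := joint_quadratic 1 1 (- 2) 0 bg.
have [m0 E0] := joint_quadratic 0 0 0 0 bg.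
have : joint (fun x y => 0 * g x ^+ 2 + 0 * g y ^+ 2 + 0 * (g x * g y) + 0) <=
    joint (fun x y => 1 * g x ^+ 2 + 1 * g y ^+ 2 + (- 2) * (g x * g y) + 0).
  apply: le_joint => // x y; rewrite -subr_ge0.
  rewrite (_ : _ - _ = (g x - g y) ^+ 2) ?sqr_ge0//.
  by move: (g x) (g y) => u v; ring.
rewrite E E0; move: (ip pi g g) (ip pi g (mop K g)) => u v; lra.
Qed.

(** The expectation of (g x + g y)^2 is 2 |g|^2 + 2 <g, P g>.  The part of it
    coming from the event y = x, which has conditional probability at least 1/2,
    is already 2 |g|^2. *)
Lemma ip_mop_ge0 g : lazy K -> bmeas g -> 0 <= ip pi g (mop K g).
Proof.
move=> lz bg; have [m E] := joint_quadratic 1 1 2 0 bg.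
suff : \int[pi]_x (2 * g x ^+ 2) <=
    joint (fun x y => 1 * g x ^+ 2 + 1 * g y ^+ 2 + 2 * (g x * g y) + 0).
  rewrite E RintZ//; solve_bmeas.
  rewrite (_ : \int[pi]_x (g x ^+ 2) = ip pi g g); first by lra.
  by apply: eq_Rintegral => x _; rewrite expr2.
apply: le_Rint => //; solve_bmeas; [exact: m.2|move=> x].
have [mx Kx] := lz x.
have {}Kx : 2^-1 <= fine (K x [set x]).
  rewrite -lee_fin fineK// ge0_fin_numE// (@le_lt_trans _ _ 1%E) ?ltry// -(K1 x).
  by apply: le_measure => //; rewrite inE.
apply: (@le_trans _ _ (mop K (fun y => 4 * g x ^+ 2 * \1_[set x] y) x)).
  rewrite /mop RintZ//; last exact: bmeas_indic.
  by rewrite Rint_indic//; have := sqr_ge0 (g x); nra.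
apply: le_Rint => //; [solve_bmeas => //|exact: m.1|move=> y].
have [->|yx] := pselect (y = x); rewrite indicE.
  by rewrite mem_set// mulr1; lra.
by rewrite memNset// mulr0; have := sqr_ge0 (g x + g y); lra.
Qed.

End joint_expectation.

(** * Cheeger's inequality *)

Section median.
Context d (T : measurableType d) (R : realType).
Variable pi : probability T R.

Lemma nondecreasing_union_le (F : (set T)^nat) (a : \bar R) :
  (forall n, measurable (F n)) -> {homo F : n m / (n <= m)%N >-> (n <= m)%O} ->
  (forall n, pi (F n) <= a)%E -> (pi (\bigcup_n F n) <= a)%E.
Proof.
move=> mF ndF Fa; have mU : measurable (\bigcup_n F n) by exact: bigcup_measurable.
have cF := @nondecreasing_cvg_mu _ _ _ pi F mF mU ndF.
rewrite -(cvg_lim _ cF)//; apply: lime_le; first by apply/cvg_ex; exists (pi (\bigcup_n F n)).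
by apply: nearW.
Qed.

Lemma bmeas_gt (f : T -> R) t : bmeas f -> measurable [set x | t < f x].
Proof.
move=> [mf _]; rewrite (_ : [set x | _] = setT `&` f @^-1` `]t, +oo[).
  by apply: mf => //; exact: measurable_itv.
by rewrite setTI; apply/seteqP; split => x /=; rewrite in_itv/= andbT.
Qed.

Lemma bmeas_ge (f : T -> R) t : bmeas f -> measurable [set x | t <= f x].
Proof.
move=> [mf _]; rewrite (_ : [set x | _] = setT `&` f @^-1` `[t, +oo[).
  by apply: mf => //; exact: measurable_itv.
by rewrite setTI; apply/seteqP; split => x /=; rewrite in_itv/= andbT.
Qed.

Lemma bmeas_lt (f : T -> R) t : bmeas f -> measurable [set x | f x < t].
Proof.
move=> [mf _]; rewrite (_ : [set x | _] = setT `&` f @^-1` `]-oo, t[).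
  by apply: mf => //; exact: measurable_itv.
by rewrite setTI; apply/seteqP; split => x /=; rewrite in_itv/=.
Qed.

(** The infimum of the levels t with pi (f > t) <= 1/2 works: both sets are
    increasing unions of level sets at neighbouring levels, so continuity of
    measure from below applies. *)
Lemma median (f : T -> R) : bmeas f -> exists m,
  (pi [set x | (m < f x)%R] <= 2^-1%:E)%E /\ (pi [set x | (f x < m)%R] <= 2^-1%:E)%E.
Proof.
move=> bf; have [mf [C fC]] := bf.
pose S := [set t : R | (pi [set x | (t < f x)%R] <= 2^-1%:E)%E].
have SC : S C.
  rewrite /S/= (_ : [set x | _] = set0) ?measure0 ?lee_fin ?invr_ge0//.
  by rewrite -subset0 => x /=; rewrite ltNge (le_trans (ler_norm _) (fC x)).
have lbS : lbound S (- C).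
  move=> t St; rewrite leNgt; apply/negP => tC.
  have : (pi [set x | (t < f x)%R] <= 2^-1%:E)%E by [].
  rewrite (_ : [set x | _] = setT); first by rewrite probability_setT lee_fin; lra.
  rewrite -subTset => x _ /=; apply: (lt_le_trans tC).
  by have := fC x; rewrite ler_norml => /andP[].
have iS : has_inf S by split; [exists C|exists (- C)].
have e_gt0 n : 0 < n.+1%:R^-1 :> R by rewrite invr_gt0.
have e_le k n : (k <= n)%N -> n.+1%:R^-1 <= k.+1%:R^-1 :> R.
  by move=> kn; rewrite lef_pV2 ?posrE// ler_nat.
exists (inf S); split.
- rewrite (_ : [set x | _] = \bigcup_n [set x | inf S + n.+1%:R^-1 < f x]).
    apply: nondecreasing_union_le => [n|k n kn|n].
    + exact: bmeas_gt.
    + apply/subsetPset => x /=; apply: le_lt_trans; rewrite lerD2l; exact: e_le.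
    + have [s Ss ls] := inf_adherent (e_gt0 n) iS.
      apply: le_trans Ss; apply: le_measure; rewrite ?inE; [exact: bmeas_gt..|].
      by move=> x /=; exact: lt_trans.
  apply/seteqP; split => [x /= xS|x [n _] /=].
    by have [n nS] := ltr_add_invr xS; exists n.
  by apply: le_lt_trans; rewrite lerDl ltW.
- rewrite (_ : [set x | _] = \bigcup_n [set x | f x < inf S - n.+1%:R^-1]).
    apply: nondecreasing_union_le => [n|k n kn|n].
    + exact: bmeas_lt.
    + apply/subsetPset => x /= /lt_le_trans; apply; rewrite lerD2l lerN2; exact: e_le.
    + set s := inf S - _.
      have nSs : ~ S s.
        by move=> /(ge_inf iS.2); rewrite leNgt gtrDl oppr_lt0 e_gt0.
      have mA : measurable [set x | s < f x] by exact: bmeas_gt.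
      apply: (@le_trans _ _ (pi (~` [set x | s < f x]))).
        apply: le_measure; rewrite ?inE; [exact: bmeas_lt|exact: measurableC|].
        by move=> x /= /ltW; rewrite leNgt => /negP.
      move/negP : nSs; rewrite -ltNge probability_setC//.
      rewrite -(fineK (fin_num_measure pi _ mA)) -EFinD lte_fin lee_fin; lra.
  apply/seteqP; split => [x /= xS|x [n _] /= /lt_le_trans].
    by have [n nS] := ltr_add_invr xS; exists n => //=; rewrite ltrBrDr.
  by apply; rewrite gerDl oppr_le0 ltW.
Qed.

End median.

Section positive_parts.
Variable R : realDomainType.
Implicit Types a m : R.

Lemma pos_neg_partsM a m : Num.max 0 (a - m) * Num.max 0 (m - a) = 0.
Proof.
have [am|ma] := leP (a - m) 0; first by rewrite mul0r.
by rewrite max_l ?mulr0//; lra.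
Qed.

Lemma pos_neg_partsE a m : a = - 1 * Num.max 0 (m - a) + (1 * Num.max 0 (a - m) + m).
Proof.
have [am|ma] := leP (a - m) 0; first by rewrite max_r; lra.
by rewrite max_l; lra.
Qed.

Lemma split_arith (k m a b u v w : R) : 0 <= k * m ^+ 2 ->
  u <= (1 - k) * a -> v <= (1 - k) * b -> 0 <= w ->
  u + v - 2 * w - m ^+ 2 <= (1 - k) * (a + b - m ^+ 2).
Proof. lra. Qed.

End positive_parts.

Section cheeger.
Context d (T : measurableType d) (R : realType).
Variables (K : R.-pker T ~> T) (pi : probability T R).
Hypothesis rev : reversible K pi.
Let pi1 : pi setT = 1%E. Proof. exact: probability_setT. Qed.
Variable c : R.
Hypothesis c0 : 0 < c.
Hypothesis iso : forall A, measurable A -> fine (pi A) <= 2^-1 ->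
  c * fine (pi A) <= ip pi \1_A (mop K \1_(~` A)).

(** Cheeger's inequality up to the error of a staircase of mesh 1/N.  Apply [iso]
    to the level sets A_k = (N g^2 >= k), all of measure at most 1/2, and sum.
    On the left, the sum of c pi(A_k) is at least c (N |g|^2 - 1).  On the right
    is the expectation of the number of k with x in A_k and y outside A_k, at
    most N (g(x)^2 - g(y)^2)^+ + 1.  With a = g x, b = g y, one has
      (a^2 - b^2)^+ <= (a^2 - b^2)/2 + (a - b)^2/(2c) + c (a + b)^2/8
    from |a^2 - b^2| = |a - b| |a + b| and the arithmetic-geometric mean
    inequality, with the weight that leads to the factor c^2/2. *)
Lemma cheeger_step (N : nat) g : (0 < N)%N -> bmeas g -> (forall x, 0 <= g x) ->
  fine (pi [set x | 0 < g x]) <= 2^-1 ->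
  c * (N%:R * ip pi g g - 1) <=
  N%:R * ((c^-1 + c / 4) * ip pi g g + (c / 4 - c^-1) * ip pi g (mop K g)) + 1.
Proof.
move=> N0 bg g0 gpi; set G := ip pi g g; set B := ip pi g (mop K g).
have bu : bmeas (fun x => N%:R * g x ^+ 2) by solve_bmeas.
have [D uD] := bu.2.
(* With this many levels the cap of [stairs] is never reached. *)
pose m := (Num.truncn D).+1.
have um x : N%:R * g x ^+ 2 <= m%:R.
  by rewrite (le_trans (ler_norm _))// (le_trans (uD x))// ltW// truncnS_gt.
have u0 x : 0 <= N%:R * g x ^+ 2 by rewrite mulr_ge0 ?sqr_ge0.
pose A k := [set x | k%:R <= N%:R * g x ^+ 2].
have mA k : measurable (A k) by exact: bmeas_ge.
have A1 k x : \1_(A k) x = (k%:R <= N%:R * g x ^+ 2)%R%:R :> R.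
  by rewrite indicE; congr (_%:R); congr nat_of_bool; apply/idP/idP; rewrite inE.
have A1C k x : \1_(~` A k) x = 1 - (k%:R <= N%:R * g x ^+ 2)%R%:R :> R.
  by rewrite -A1 !indicE in_setC; case: (_ \in _); rewrite ?subrr ?subr0.
pose r := index_iota 1 m.+1.
have mJ k : jmeas K (fun x y => \1_(A k) x * \1_(~` A k) y).
  by apply: jmeasM; apply: bmeas_indic => //; exact: measurableC.
have [mJr EJr] := joint_sum pi r mJ.
(* The coefficients of a^2, b^2 and ab in N times the quadratic bound. *)
pose al : R := N%:R * (2^-1 + (2 * c)^-1 + c / 8).
pose be : R := N%:R * (- 2^-1 + (2 * c)^-1 + c / 8).
pose ga : R := N%:R * (c / 4 - c^-1).
have [mQ EQ] := joint_quadratic rev al be ga 1 bg.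
apply: (@le_trans _ _ (\sum_(k <- r) joint K pi (fun x y => \1_(A k) x * \1_(~` A k) y))).
  apply: (@le_trans _ _ (\sum_(k <- r) c * fine (pi (A k)))).
    rewrite -mulr_sumr ler_pM2l//.
    have -> : \sum_(k <- r) fine (pi (A k)) =
        \int[pi]_x stairs m (N%:R * g x ^+ 2).
      under eq_bigr => k _ do rewrite -Rint_indic//.
      rewrite -Rint_sum//; last by move=> k; exact: bmeas_indic.
      by apply: eq_Rintegral => x _; apply: eq_bigr => k _; rewrite A1.
    have -> : N%:R * G - 1 = \int[pi]_x (N%:R * g x ^+ 2 - 1).
      rewrite RintD//; solve_bmeas; rewrite Rint_cst// RintZ//; solve_bmeas.
    apply: le_Rint => //; solve_bmeas; last by move=> x; exact: stairs_ge.
    rewrite (_ : (fun _ => _) = fun x => \sum_(k <- r) \1_(A k) x).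
      by apply: bmeas_sum => k; exact: bmeas_indic.
    by apply/funext => x; apply: eq_bigr => k _; rewrite A1.
  rewrite big_seq [leRHS]big_seq; apply: ler_sum => k.
  rewrite mem_index_iota => /andP[k1 _].
  rewrite jointM; [|exact: bmeas_indic|by apply: bmeas_indic; exact: measurableC].
  apply: iso => //; apply: le_trans gpi.
  apply: fine_le; [exact: fin_num_measure|..].
    by apply: fin_num_measure; exact: bmeas_gt.
  apply: le_measure; rewrite ?inE//; first exact: bmeas_gt.
  move=> x /=; rewrite lt_neqAle g0 andbT => kx; apply/eqP => gx0.
  move: kx; rewrite /A/= -gx0 expr0n/= mulr0 lern0 => /eqP k0.
  by rewrite k0 in k1.
rewrite -EJr.
have -> : N%:R * ((c^-1 + c / 4) * G + (c / 4 - c^-1) * B) + 1 =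
    (al + be) * G + ga * B + 1.
  by rewrite /al /be /ga; field; rewrite gt_eqF.
rewrite -EQ; apply: le_joint => // x y.
under eq_bigr do rewrite A1 A1C.
apply: (le_trans (stairs_cross (u0 x) (um y))).
rewrite lerD2r.
have -> : al * g x ^+ 2 + be * g y ^+ 2 + ga * (g x * g y) =
    N%:R * ((g x ^+ 2 - g y ^+ 2) / 2 + (g x - g y) ^+ 2 / (2 * c) +
            c / 8 * (g x + g y) ^+ 2).
  by rewrite /al /be /ga; field; rewrite gt_eqF.
rewrite -mulrBr -[X in Num.max X _](mulr0 N%:R) -maxr_pMr//.
rewrite ler_wpM2l// ge_max.
set a := g x; set b := g y.
(* The bound is a multiple of a square, and so is its excess over a^2 - b^2. *)
have -> : (a ^+ 2 - b ^+ 2) / 2 + (a - b) ^+ 2 / (2 * c) + c / 8 * (a + b) ^+ 2 =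
  c / 8 * ((a + b) + 2 / c * (a - b)) ^+ 2 by field; rewrite gt_eqF.
have -> : (a ^+ 2 - b ^+ 2 <= c / 8 * (a + b + 2 / c * (a - b)) ^+ 2) =
  (0 <= c / 8 * (a + b - 2 / c * (a - b)) ^+ 2).
  by rewrite -subr_ge0; congr (_ <= _); field; rewrite gt_eqF.
have c8 : 0 <= c / 8 by rewrite divr_ge0// ltW.
by apply/andP; split; apply: mulr_ge0 => //; exact: sqr_ge0.
Qed.

(** Let N tend to infinity in [cheeger_step].  With E = |g|^2 - <g, P g> the limit
    reads c^2/2 |g|^2 <= (1 - c^2/4) E, and E >= 0. *)
Lemma cheeger_half g : bmeas g -> (forall x, 0 <= g x) ->
  fine (pi [set x | 0 < g x]) <= 2^-1 ->
  ip pi g (mop K g) <= (1 - c ^+ 2 / 2) * ip pi g g.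
Proof.
move=> bg g0 gpi; set G := ip pi g g; set B := ip pi g (mop K g).
have BG : B <= G by exact: ip_mop_le.
have G0 : 0 <= G by exact: ip_ge0.
(* The conclusion of [cheeger_step] is N X <= c + 1 for every N. *)
pose X := c * G - ((c^-1 + c / 4) * G + (c / 4 - c^-1) * B).
have X0 : X <= 0.
  rewrite leNgt; apply/negP => X0.
  have := cheeger_step (ltn0Sn (Num.truncn ((c + 1) / X))) bg g0 gpi.
  rewrite -/G -/B leNgt => /negP; apply.
  have := truncnS_gt ((c + 1) / X); rewrite ltr_pdivrMr// /X; lra.
have : c * X <= 0 by rewrite pmulr_rle0.
have -> : c * X = 3 / 4 * c ^+ 2 * G - G + (1 - c ^+ 2 / 4) * B.
  by rewrite /X; field; rewrite gt_eqF.
have : 0 <= c ^+ 2 / 4 * (G - B) by rewrite mulr_ge0 ?subr_ge0// divr_ge0 ?sqr_ge0.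
by lra.
Qed.

(** Let p and q be the positive and negative parts of g - m, with m a median; both
    satisfy [cheeger_half].  They are orthogonal while <p, P q> >= 0, so
    <g - m, P (g - m)> is at most <p, P p> + <q, P q>.  Since g has mean zero,
    returning from g - m to g subtracts m^2 from both quadratic forms, which is
    in the right direction. *)
Lemma cheeger g : bmeas g -> \int[pi]_x g x = 0 ->
  ip pi g (mop K g) <= (1 - c ^+ 2 / 2) * ip pi g g.
Proof.
move=> bg gmean; have [m [gm mg]] := median pi bg.
pose p x := Num.max 0 (g x - m); pose q x := Num.max 0 (m - g x).
have bp : bmeas p by rewrite /p; solve_bmeas.
have bq : bmeas q by rewrite /q; solve_bmeas.
have p0 x : 0 <= p x by rewrite le_max lexx.
have q0 x : 0 <= q x by rewrite le_max lexx.
have le_half A : measurable A -> (pi A <= 2^-1%:E)%E -> fine (pi A) <= 2^-1.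
  by move=> mA; rewrite -{1}(fineK (fin_num_measure pi _ mA)) lee_fin.
have Cp : ip pi p (mop K p) <= (1 - c ^+ 2 / 2) * ip pi p p.
  apply: cheeger_half => //; apply: le_half; first exact: bmeas_gt.
  rewrite (_ : [set x | _] = [set x | m < g x])//.
  by apply/seteqP; split => x /=; rewrite lt_max ltxx subr_gt0.
have Cq : ip pi q (mop K q) <= (1 - c ^+ 2 / 2) * ip pi q q.
  apply: cheeger_half => //; apply: le_half; first exact: bmeas_gt.
  rewrite (_ : [set x | _] = [set x | g x < m])//.
  by apply/seteqP; split => x /=; rewrite lt_max ltxx subr_gt0.
have pq0 : ip pi p q = 0.
  rewrite /ip; under eq_Rintegral do rewrite pos_neg_partsM.
  by rewrite Rint_cst.
have pPq : 0 <= ip pi p (mop K q).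
  by apply: Rint_ge0 => x; rewrite mulr_ge0// mop_ge0.
have gE : g = fun x => - 1 * q x + (1 * p x + m).
  by apply/funext => x; exact: pos_neg_partsE.
have bP f : bmeas f -> bmeas (mop K f) by exact: bmeas_mop.
have sm f : bmeas f -> ip pi f (fun=> m) = m * \int[pi]_x f x.
  by move=> bf; rewrite -RintZ//; apply: eq_Rintegral => x _; rewrite mulrC.
have ms f : bmeas f -> ip pi (fun=> m) f = m * \int[pi]_x f x.
  by move=> bf; rewrite ipC sm.
have bpm : bmeas (fun x => 1 * p x + m) by solve_bmeas.
have bm : bmeas (fun _ : T => m) by exact: bmeas_cst.
have mm : \int[pi]_x p x = \int[pi]_x q x - m.
  apply/eqP; rewrite eq_sym subr_eq -subr_eq0 opprD addrA -oppr_eq0.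
  apply/eqP; rewrite -[RHS]gmean [in RHS]gE RintD//; last by solve_bmeas.
  rewrite (RintD pi1 (f := fun x => 1 * p x))//; last by solve_bmeas.
  by rewrite !RintZ// Rint_cst//; ring.
have Ig : ip pi g g = ip pi p p + ip pi q q - m ^+ 2.
  rewrite [in LHS]gE (ipl pi1 (-1) bq bpm) -?gE//.
  rewrite (ipl pi1 1 bp bm)// {1 2}gE.
  rewrite !(ipr pi1 (-1) bq bpm)// !(ipr pi1 1 bp bm)// ms// gmean.
  by rewrite (ipC _ q p) pq0 !sm// mm; ring.
have Bg : ip pi g (mop K g) = ip pi p (mop K p) + ip pi q (mop K q)
    - 2 * ip pi p (mop K q) - m ^+ 2.
  have PgE : mop K g = fun x => - 1 * mop K q x + (1 * mop K p x + m).
    by rewrite [in LHS]gE mopl// mopl// mop_cst.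
  have bPg := bP g bg.
  rewrite [in LHS]gE (ipl pi1 (-1) bq bpm) -?gE//.
  rewrite (ipl pi1 1 bp bm)// ms// mop_stationary// gmean PgE.
  have bPpm : bmeas (fun x => 1 * mop K p x + m) by solve_bmeas; exact: bP.
  rewrite !(ipr pi1 (-1) (bP q bq) bPpm)// !(ipr pi1 1 (bP p bp) bm)// !sm//.
  rewrite (mop_sym rev bq bp) mm.
  move: (ip pi p (mop K p)) (ip pi q (mop K q)) (ip pi p (mop K q)) => u v w.
  by move: (\int[pi]_x q x) => e; ring.
rewrite Ig Bg; apply: split_arith => //.
by rewrite mulr_ge0 ?divr_ge0 ?sqr_ge0.
Qed.

End cheeger.

(** * Decay of correlations *)

Section geometric_sums.
Variables (R : realFieldType) (b : R).
Hypotheses (b0 : 0 <= b) (b1 : b < 1).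

Lemma geometric_le m : \sum_(0 <= k < m) b ^+ k <= (1 - b)^-1.
Proof.
rewrite -[leRHS]mul1r ler_pdivlMr ?subr_gt0// big_mkord mulrC -opprB mulNr.
by rewrite -subrX1 opprB gerBl exprn_ge0.
Qed.

(** The exponent is |i - j|; the row is made of two geometric series. *)
Lemma geometric_row_le i n : (i < n)%N ->
  \sum_(0 <= j < n) b ^+ ((i - j) + (j - i)) <= 2 / (1 - b).
Proof.
move=> i_n; rewrite (@big_cat_nat _ _ _ i.+1)//= mulr2n mulrDl mul1r lerD//.
- rewrite big_nat_rev/=; apply: le_trans (geometric_le i.+1).
  rewrite big_nat [leRHS]big_nat; apply: ler_sum => k /andP[_ ki].
  rewrite add0n subSS subKn//.
  by rewrite (_ : (i - k - i)%N = 0%N) ?addn0//; apply/eqP; rewrite subn_eq0 leq_subr.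
- rewrite -{1}[i.+1]add0n big_addn; apply: le_trans (geometric_le (n - i.+1)).
  apply: ler_sum => k _; rewrite addnS -addSn addnK.
  rewrite (_ : (i - (k.+1 + i))%N = 0%N) ?add0n; last by apply/eqP; rewrite subn_eq0 leq_addl.
  by rewrite exprS ler_piMl ?exprn_ge0// ltW.
Qed.

End geometric_sums.

Lemma contraction_arith (R : realFieldType) (b A G u v : R) :
  0 <= b -> 0 <= A -> 0 <= G -> 0 <= u -> 0 <= v -> u <= b * A -> v <= b * G ->
  A ^+ 2 <= u * v -> A <= b ^+ 2 * G.
Proof.
move=> b0 A0 G0 u0 v0 uA vG Auv.
have [->|An0] := eqVneq A 0; first by rewrite mulr_ge0 ?exprn_ge0.
have Apos : 0 < A by rewrite lt0r An0.
rewrite -(ler_pM2l Apos) -expr2 (le_trans Auv)//.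
by rewrite (_ : A * _ = (b * A) * (b * G)) ?ler_pM//; ring.
Qed.

Section contraction.
Context d (T : measurableType d) (R : realType).
Variables (K : R.-pker T ~> T) (pi : probability T R).
Hypothesis rev : reversible K pi.
Hypothesis lz : lazy K.
Let pi1 : pi setT = 1%E. Proof. exact: probability_setT. Qed.
Variable b : R.
Hypothesis b0 : 0 <= b.
Hypothesis gap : forall g, bmeas g -> \int[pi]_x g x = 0 ->
  ip pi g (mop K g) <= b * ip pi g g.
Implicit Types f g h r : T -> R.

(** The form <u, P v> is symmetric and nonnegative, so by Cauchy-Schwarz
    |P g|^4 = <g, P (P g)>^2 <= <g, P g> <P g, P (P g)> <= b^2 |g|^2 |P g|^2. *)
Lemma nrm_mop_le g : bmeas g -> \int[pi]_x g x = 0 ->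
  nrm pi (mop K g) <= b * nrm pi g.
Proof.
move=> bg g0; have bPg := bmeas_mop K bg; have bPPg := bmeas_mop K bPg.
have gapP : ip pi (mop K g) (mop K (mop K g)) <= b * ip pi (mop K g) (mop K g).
  by apply: gap => //; rewrite mop_stationary.
have disc : ip pi (mop K g) (mop K g) ^+ 2 <=
    ip pi (mop K g) (mop K (mop K g)) * ip pi g (mop K g).
  apply: discriminant_le => [|t]; first exact: ip_mop_ge0.
  have bt : bmeas (fun x => - t * g x + mop K g x) by solve_bmeas.
  have := ip_mop_ge0 rev lz bt; rewrite mopl//.
  rewrite (ipl pi1 (- t) bg bPg); last by solve_bmeas.
  rewrite (ipr pi1 (- t) bPg bPPg bg) (ipr pi1 (- t) bPg bPPg bPg) (mop_sym rev bg bPg).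
  move: (ip pi g (mop K g)) (ip pi (mop K g) (mop K (mop K g))).
  move: (ip pi (mop K g) (mop K g)) => a u v.
  by congr (0 <= _); ring.
have AG : ip pi (mop K g) (mop K g) <= b ^+ 2 * ip pi g g.
  by apply: contraction_arith disc => //; [exact: ip_ge0|exact: ip_ge0|
    exact: ip_mop_ge0|exact: ip_mop_ge0|exact: gap].
rewrite -(@ler_pXn2r _ 2)// ?nnegrE ?mulr_ge0 ?nrm_ge0//.
by rewrite exprMn !nrm_sqr.
Qed.

Lemma iter_mop_mean i g : bmeas g ->
  \int[pi]_x iter i (mop K) g x = \int[pi]_x g x.
Proof.
by move=> bg; elim: i => //= i <-; rewrite mop_stationary//; exact: bmeas_iter_mop.
Qed.

Lemma nrm_iter_mop_le i g : bmeas g -> \int[pi]_x g x = 0 ->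
  nrm pi (iter i (mop K) g) <= b ^+ i * nrm pi g.
Proof.
move=> bg g0; elim: i => [|i IH]; first by rewrite mul1r.
rewrite iterS (le_trans (nrm_mop_le _ _))//.
- exact: bmeas_iter_mop.
- by rewrite iter_mop_mean.
- by rewrite exprS -mulrA ler_wpM2l.
Qed.

Lemma iter_mop_sym i f g : bmeas f -> bmeas g ->
  ip pi f (iter i (mop K) g) = ip pi g (iter i (mop K) f).
Proof.
move=> bf; elim: i g => [|i IH] g bg; first exact: ipC.
rewrite iterSr IH; last exact: bmeas_mop.
by rewrite ipC mop_sym//; exact: bmeas_iter_mop.
Qed.

Lemma nrmM_le f g L : bmeas f -> bmeas g -> 0 <= L -> (forall x, `|f x| <= L) ->
  nrm pi (fun x => f x * g x) <= L * nrm pi g.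
Proof.
move=> bf bg L0 fL; apply: nrm_le; rewrite ?mulr_ge0 ?nrm_ge0//; first by solve_bmeas.
rewrite exprMn nrm_sqr /ip -RintZ//; last by solve_bmeas.
apply: le_Rint => //; solve_bmeas; move=> x.
have -> : f x * g x * (f x * g x) = f x ^+ 2 * (g x * g x) by ring.
rewrite ler_wpM2r -?expr2 ?sqr_ge0//.
by rewrite -[f x ^+ 2]ger0_norm ?sqr_ge0// normrX lerXn2r ?nnegrE.
Qed.

(** Moving P^i onto r and writing r = 1 + (r - 1) gives <g, P^k g>, the covariance
    in the stationary regime, plus <P^i (r - 1), g . P^k g>, the memory of the
    initial law.  The function r - 1 has mean zero, so both terms decay by
    [nrm_iter_mop_le]. *)
Lemma correlation_le i k r g L : bmeas r -> bmeas g -> 0 <= L ->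
  (forall x, `|g x| <= L) -> \int[pi]_x r x = 1 -> \int[pi]_x g x = 0 ->
  `|ip pi r (iter i (mop K) (fun x => g x * iter k (mop K) g x))| <=
  b ^+ k * (nrm pi g ^+ 2 + nrm pi (fun x => r x - 1) * b ^+ i * L * nrm pi g).
Proof.
move=> br bg L0 gL r1 g0; set r' := fun x => r x - 1.
have br' : bmeas r' by rewrite /r'; solve_bmeas.
set w := iter k (mop K) g; have bw : bmeas w by exact: bmeas_iter_mop.
have bh : bmeas (fun x => g x * w x) by solve_bmeas.
have r'0 : \int[pi]_x r' x = 0 by rewrite RintD//; solve_bmeas; rewrite r1 Rint_cst// subrr.
set v := iter i (mop K) r'; have bv : bmeas v by exact: bmeas_iter_mop.
have -> : ip pi r (iter i (mop K) (fun x => g x * w x)) =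
    ip pi g w + ip pi (fun x => g x * v x) w.
  have -> : r = fun x => 1 * r' x + 1 by apply/funext => x; rewrite /r'; ring.
  rewrite (ipl pi1 1 br' (bmeas_cst T 1)); last exact: bmeas_iter_mop.
  rewrite iter_mop_sym// -/v mul1r addrC; congr (_ + _).
    rewrite [LHS](_ : _ = \int[pi]_x iter i (mop K) (fun x => g x * w x) x).
      by rewrite iter_mop_mean.
    by apply: eq_Rintegral => x _; rewrite mul1r.
  by apply: eq_Rintegral => x _; ring.
have wk : nrm pi w <= b ^+ k * nrm pi g by exact: nrm_iter_mop_le.
have vi : nrm pi v <= b ^+ i * nrm pi r' by exact: nrm_iter_mop_le.
have gv : nrm pi (fun x => g x * v x) <= L * (b ^+ i * nrm pi r').
  by rewrite (le_trans (nrmM_le bg bv L0 gL))// ler_wpM2l.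
have bgv : bmeas (fun x => g x * v x) by solve_bmeas.
rewrite (le_trans (ler_normD _ _))//.
have -> : b ^+ k * (nrm pi g ^+ 2 + nrm pi r' * b ^+ i * L * nrm pi g) =
    nrm pi g * (b ^+ k * nrm pi g) +
    (L * (b ^+ i * nrm pi r')) * (b ^+ k * nrm pi g) by ring.
apply: lerD.
  by rewrite (le_trans (norm_ip_le pi1 bg bw))// ler_wpM2l ?nrm_ge0.
by rewrite (le_trans (norm_ip_le pi1 bgv bw))// ler_pM ?nrm_ge0.
Qed.

End contraction.

(** * Moments of the chain *)

Section chain_moments.
Context d (Omega : measurableType d) (R : realType).
Context d' (T : measurableType d') (P : probability T R).
Variables (K : R.-pker Omega ~> Omega) (nu : probability Omega R).
Variable X : nat -> {RV P >-> Omega}.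
Hypothesis mkX : markov_chain nu K X.
Implicit Types g h : Omega -> R.
Let P1 : P setT = 1%E. Proof. exact: probability_setT. Qed.

Lemma bmeas_X i g : bmeas g -> bmeas (fun w => g (X i w)).
Proof. by move=> bg; exact: (bmeas_comp (measurable_funPT (X i)) bg). Qed.

(** For indicators this is the defining property of the chain on the event
    that X_i lies in B, which belongs to the past of time n. *)
Lemma markov_step i n g h : (i <= n)%N -> bmeas g -> bmeas h ->
  \int[P]_w (g (X i w) * h (X n.+1 w)) = \int[P]_w (g (X i w) * mop K h (X n w)).
Proof.
move=> i_n bg bh.
pose Phi u v := \int[P]_w (u (X i w) * v (X n.+1 w)).
pose Psi u v := \int[P]_w (u (X i w) * mop K v (X n w)).
have linL (F : T -> R) : bmeas F ->
    bounded_linear (fun u => \int[P]_w (u (X i w) * F w)).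
  move=> bF; split=> [c u v bu bv|].
    have bui := bmeas_X i bu; have bvi := bmeas_X i bv.
    rewrite -RintZ//; solve_bmeas; rewrite -RintD//; solve_bmeas.
    by apply: eq_Rintegral => w _; ring.
  have [C FC] := bF.2; exists C => u e bu ue.
  have bui := bmeas_X i bu.
  by apply: ler_norm_Rint => //; [solve_bmeas|move=> w; rewrite normrM mulrC ler_pM].
have linR (F : T -> R) : bmeas F ->
    bounded_linear (fun v => \int[P]_w (F w * v (X n.+1 w))).
  move=> bF; split=> [c u v bu bv|].
    have bui := bmeas_X n.+1 bu; have bvi := bmeas_X n.+1 bv.
    rewrite -RintZ//; solve_bmeas; rewrite -RintD//; solve_bmeas.
    by apply: eq_Rintegral => w _; ring.
  have [C FC] := bF.2; exists C => u e bu ue.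
  have bui := bmeas_X n.+1 bu.
  by apply: ler_norm_Rint => //; [solve_bmeas|move=> w; rewrite normrM ler_pM].
have linR' (F : T -> R) : bmeas F ->
    bounded_linear (fun v => \int[P]_w (F w * mop K v (X n w))).
  move=> bF; split=> [c u v bu bv|].
    have bui := bmeas_X n (bmeas_mop K bu); have bvi := bmeas_X n (bmeas_mop K bv).
    rewrite -RintZ//; solve_bmeas; rewrite -RintD//; solve_bmeas.
    by apply: eq_Rintegral => w _; rewrite mopl//; ring.
  have [C FC] := bF.2; exists C => u e bu ue.
  have bui := bmeas_X n (bmeas_mop K bu).
  apply: ler_norm_Rint => //; [solve_bmeas|move=> w; rewrite normrM ler_pM//].
  exact: mop_norm.
apply: (bounded_linear_ext (linR _ (bmeas_X i bg)) (linR' _ (bmeas_X i bg))) bh.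
move=> A mA.
have b1A := bmeas_indic R mA.
apply: (bounded_linear_ext (linL _ (bmeas_X n.+1 b1A))
  (linL _ (bmeas_X n (bmeas_mop K b1A)))) bg.
move=> B mB; have b1B := bmeas_indic R mB; apply: EFin_inj.
have bX1 := bmeas_X i b1B; have bX2 := bmeas_X n.+1 b1A.
have bX3 := bmeas_X n (bmeas_mop K b1A).
rewrite (EFin_Rintegral P1 (bmeasM bX1 bX2)) (EFin_Rintegral P1 (bmeasM bX1 bX3)).
pose E := X i @^-1` B.
transitivity (P (E `&` X n.+1 @^-1` A)).
  have mXi j D : measurable D -> measurable (X j @^-1` D).
    by move=> mD; rewrite -[X in measurable X]setTI; exact: measurable_funP.
  rewrite -[X in P X]setIT -integral_indic//; last by apply: measurableI; exact: mXi.
  by apply: eq_integral => w _; rewrite indicI.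
rewrite mkX.2//; last first.
  apply: sub_sigma_algebra; have i_n1 : (i < n.+1)%N by [].
  rewrite (bigD1 (Ordinal i_n1))//=; left; exists B => //.
  by rewrite setTI.
rewrite [LHS]integral_mkcond; apply: eq_integral => w _.
rewrite patchE mop_indic// indicE.
have -> : (w \in E) = (X i w \in B) by apply/idP/idP; rewrite !inE.
case: (_ \in B); last by rewrite mul0r.
rewrite mul1r fineK// ge0_fin_numE// (@le_lt_trans _ _ 1%E) ?ltry//.
rewrite -(@prob_kernel _ _ _ _ _ K (X n w)).
by apply: le_measure => //; rewrite inE.
Qed.

Lemma markov_iter i k g h : bmeas g -> bmeas h ->
  \int[P]_w (g (X i w) * h (X (i + k)%N w)) =
  \int[P]_w (g (X i w) * iter k (mop K) h (X i w)).
Proof.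
move=> bg; elim: k h => [|k IH] h bh; first by rewrite addn0.
rewrite addnS markov_step ?leq_addr// IH; last exact: bmeas_mop.
by rewrite iterSr.
Qed.

Lemma chain_mean i h : bmeas h ->
  \int[P]_w h (X i w) = \int[nu]_x iter i (mop K) h x.
Proof.
move=> bh; have := markov_iter 0 i (bmeas_cst Omega 1) bh.
rewrite add0n.
under eq_Rintegral do rewrite mul1r; under [in RHS]eq_Rintegral do rewrite mul1r.
move=> ->; have [m _] := bmeas_iter_mop K i bh.
have bi := bmeas_iter_mop K i bh.
apply: EFin_inj; rewrite !EFin_Rintegral//; try exact: probability_setT.
  rewrite -[LHS](integral_distribution (X := X 0%N)
    (f := fun x => (iter i (mop K) h x)%:E)).
  - by apply: eq_measure_integral => A mA _; exact: (mkX.1 A mA).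
  - exact/measurable_EFinP.
  - exact/(bmeas_integrable P1)/bmeas_X.
exact: bmeas_X.
Qed.

Lemma chain_covariance i k g : bmeas g ->
  \int[P]_w (g (X i w) * g (X (i + k)%N w)) =
  \int[nu]_x iter i (mop K) (fun x => g x * iter k (mop K) g x) x.
Proof.
move=> bg; rewrite markov_iter// -chain_mean//.
by apply: bmeasM => //; exact: bmeas_iter_mop.
Qed.

End chain_moments.

Section mean_square.
Context d (Omega : measurableType d) (R : realType).
Context d' (T : measurableType d') (P : probability T R).
Variables (K : R.-pker Omega ~> Omega) (pi nu : probability Omega R).
Variable X : nat -> {RV P >-> Omega}.
Hypothesis mkX : markov_chain nu K X.
Hypothesis rev : reversible K pi.
Hypothesis lz : lazy K.
Variable b : R.
Hypotheses (b0 : 0 <= b) (b1 : b < 1).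
Hypothesis gap : forall g, bmeas g -> \int[pi]_x g x = 0 ->
  ip pi g (mop K g) <= b * ip pi g g.
Variable r : Omega -> R.
Hypothesis br : bmeas r.
Hypothesis nur : forall h, bmeas h -> \int[nu]_x h x = ip pi r h.
Variables (g : Omega -> R) (L : R).
Hypotheses (bg : bmeas g) (L0 : 0 <= L) (gL : forall x, `|g x| <= L).
Hypothesis g0 : \int[pi]_x g x = 0.
Let P1 : P setT = 1%E. Proof. exact: probability_setT. Qed.
Let pi1 : pi setT = 1%E. Proof. exact: probability_setT. Qed.

Let W n0 := nrm pi g ^+ 2 + nrm pi (fun x => r x - 1) * b ^+ n0 * L * nrm pi g.

Lemma density_mean : \int[pi]_x r x = 1.
Proof.
have := nur (bmeas_cst Omega 1); rewrite (Rint_cst (probability_setT nu)) => ->.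
by apply: eq_Rintegral => x _; rewrite mulr1.
Qed.

(** [correlation_le] for the pair in increasing order; the exponent is |i - j|. *)
Lemma covariance_le n0 i j : (n0 <= i)%N -> (n0 <= j)%N ->
  `|\int[P]_w (g (X i w) * g (X j w))| <= b ^+ ((i - j) + (j - i)) * W n0.
Proof.
wlog ij : i j / (i <= j)%N => [H|n0i n0j].
  move=> n0i n0j; have [/H|/ltnW/H] := leqP i j; first exact.
  by rewrite addnC; under eq_Rintegral do rewrite mulrC; exact.
rewrite -(subnKC ij) (chain_covariance mkX)//.
rewrite nur; last by apply: bmeas_iter_mop; solve_bmeas; exact: bmeas_iter_mop.
apply: le_trans (correlation_le rev lz b0 gap _ _ br bg L0 gL density_mean g0) _.
rewrite subnKC// (eqP ij) add0n ler_wpM2l ?exprn_ge0// lerD2l.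
rewrite !ler_wpM2r ?nrm_ge0// ler_wpM2l ?nrm_ge0//.
by apply: ler_wiXn2l => //; exact: ltW.
Qed.

(** Expand the square; each of the n rows of covariances sums to at most
    2/(1 - b) W. *)
Lemma mean_square_le n n0 : (0 < n)%N ->
  \int[P]_w (n%:R^-1 * \sum_(1 <= j < n.+1) g (X (n0 + j)%N w)) ^+ 2 <=
  2 / (1 - b) / n%:R * W n0.
Proof.
move=> n_gt0; have n0R : 0 < n%:R :> R by rewrite ltr0n.
have bX j : bmeas (fun w => g (X j w)) by exact: (bmeas_comp (measurable_funPT (X j)) bg).
have W0 : 0 <= W n0.
  by rewrite addr_ge0 ?sqr_ge0// !mulr_ge0 ?exprn_ge0 ?nrm_ge0.
pose c i j := \int[P]_w (g (X (n0 + i)%N w) * g (X (n0 + j)%N w)).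
have -> : \int[P]_w (n%:R^-1 * \sum_(1 <= j < n.+1) g (X (n0 + j)%N w)) ^+ 2 =
    n%:R^-1 ^+ 2 * \sum_(1 <= i < n.+1) \sum_(1 <= j < n.+1) c i j.
  transitivity (\int[P]_w (n%:R^-1 ^+ 2 * \sum_(1 <= i < n.+1)
      \sum_(1 <= j < n.+1) g (X (n0 + i)%N w) * g (X (n0 + j)%N w))).
    apply: eq_Rintegral => w _.
    by rewrite exprMn [X in _ * X]expr2 big_distrlr.
  have bij i j : bmeas (fun w => g (X (n0 + i)%N w) * g (X (n0 + j)%N w)).
    exact: bmeasM.
  rewrite RintZ//; last by do 2 apply: bmeas_sum => ?.
  rewrite Rint_sum//; last by move=> i; exact: bmeas_sum.
  by congr (_ * _); apply: eq_bigr => i _; rewrite Rint_sum.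
apply: (@le_trans _ _ (n%:R^-1 ^+ 2 * (n%:R * (2 / (1 - b) * W n0)))); last first.
  by rewrite le_eqVlt; apply/orP; left; apply/eqP; field; rewrite ?gt_eqF ?subr_gt0.
rewrite ler_wpM2l ?sqr_ge0//.
have -> : n%:R * (2 / (1 - b) * W n0) = \sum_(1 <= i < n.+1) (2 / (1 - b) * W n0).
  by rewrite sumr_const_nat subSS subn0 mulr_natl.
rewrite big_nat [leRHS]big_nat; apply: ler_sum => i /andP[i1 i_n].
apply: (@le_trans _ _ (\sum_(0 <= j < n) b ^+ ((i.-1 - j) + (j - i.-1)) * W n0)).
  rewrite big_add1/=; apply: ler_sum => j _.
  rewrite (le_trans (ler_norm _))// (le_trans (covariance_le (n0 := n0) _ _)) ?leq_addr//.
  by rewrite !subnDl; case: i i1 i_n => // i _ _; rewrite !subSS.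
rewrite -mulr_suml ler_wpM2r// geometric_row_le//.
by case: i i1 i_n.
Qed.

End mean_square.

(** * Essentially bounded functions, densities, conductance *)

Section essential_bounds.
Context d (T : measurableType d) (R : realType).
Variable mu : probability T R.

Lemma ae_bounded_clip (h : T -> R) (C : R) : measurable_fun setT h -> 0 <= C ->
  {ae mu, forall x, `|h x| <= C} ->
  exists h', [/\ bmeas h', forall x, `|h' x| <= C & {ae mu, forall x, h x = h' x}].
Proof.
move=> mh C0 hC.
have h'C x : `|Num.max (- C) (Num.min (h x) C)| <= C.
  rewrite ler_norml le_max lexx/= ge_max ge_min lexx orbT andbT.
  by rewrite (le_trans _ C0)// oppr_le0.
exists (fun x => Num.max (- C) (Num.min (h x) C)); split => //.
  split; last by exists C.
  by apply: measurable_maxr => //; exact: measurable_minr.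
apply: filterS hC => x; rewrite ler_norml => /andP[hl hr].
by rewrite min_l// max_r.
Qed.

Lemma ae_Lnorm_le (h : T -> \bar R) : {ae mu, forall x, `|h x| <= 'N[mu]_+oo[h]}%E.
Proof.
have -> : ('N[mu]_+oo[h] = ess_sup mu (abse \o h))%E.
  by rewrite unlock ifT//; have := @lte01 R; rewrite -(probability_setT mu).
exact: (ess_sup_ge mu (abse \o h)).
Qed.

End essential_bounds.

Section density.
Context d (T : measurableType d) (R : realType).
Variables (pi nu : probability T R).
Hypothesis nupi : nu `<< pi.
Let dnu := Radon_Nikodym (charge_of_finite_measure nu) pi.

(** The derivative is bounded by M almost everywhere only; r is obtained from it
    by clipping at - M and M, which does not change integrals. *)
Lemma bounded_density (M : R) : ('N[pi]_+oo[dnu] = M%:E)%E ->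
  exists r, [/\ bmeas r, forall x, `|r x| <= M &
    forall h, bmeas h -> \int[nu]_x h x = ip pi r h].
Proof.
move=> NM.
have M0 : 0 <= M by rewrite -lee_fin -NM Lnorm_ge0.
have intd : pi.-integrable setT dnu by exact: Radon_Nikodym_integrable.
have dE x : dnu x = (fine (dnu x))%:E by rewrite fineK// Radon_Nikodym_fin_num.
have md : measurable_fun setT dnu by exact: measurable_int intd.
have mfd : measurable_fun setT (fine \o dnu) by exact: measurableT_comp.
have [|r [br rM rE]] := @ae_bounded_clip _ _ _ pi _ _ mfd M0.
  have := ae_Lnorm_le pi dnu; rewrite NM; apply: filterS => x.
  by rewrite dE abse_EFin lee_fin.
exists r; split => // h bh.
have brh : bmeas (fun x => r x * h x) by solve_bmeas.
apply: EFin_inj; rewrite (EFin_Rintegral (probability_setT nu) bh).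
rewrite (EFin_Rintegral (probability_setT pi) brh).
rewrite -(Radon_Nikodym_change_of_variables nupi)//; last first.
  exact: (bmeas_integrable (probability_setT nu) bh).
apply: ae_eq_integral => //.
- by apply: emeasurable_funM => //; apply/measurable_EFinP; apply: bh.1.
- by apply/measurable_EFinP; apply: brh.1.
- by apply: filterS rE => x /= hr _; rewrite [X in (_ * X)%E]dE/= -EFinM mulrC hr.
Qed.

(** |r - 1|^2 = |r|^2 - 1, and |r|^2 is the mean of r under nu. *)
Lemma density_nrm_le (M : R) r : bmeas r -> (forall x, `|r x| <= M) ->
  (forall h, bmeas h -> \int[nu]_x h x = ip pi r h) ->
  nrm pi (fun x => r x - 1) <= Num.sqrt M.
Proof.
move=> br rM nur; rewrite /nrm ler_wsqrtr//.
have pi1 := probability_setT pi; have nu1 := probability_setT nu.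
have r1 := density_mean nur.
have -> : ip pi (fun x => r x - 1) (fun x => r x - 1) = ip pi r r - 1.
  rewrite /ip (_ : (fun x => _) = fun x => r x * r x + ((- 2) * r x + 1)).
    rewrite !RintD//; solve_bmeas; rewrite RintZ//.
    by rewrite r1 Rint_cst//; ring.
  by apply/funext => x; ring.
rewrite -nur// (@le_trans _ _ (\int[nu]_x r x))// ?gerDl ?oppr_le0//.
by rewrite (le_trans (ler_norm _))// ler_norm_Rint.
Qed.

End density.

Section isoperimetry.
Context d (T : measurableType d) (R : realType).
Variables (K : R.-pker T ~> T) (pi : probability T R).

(** The infimum defining the conductance ranges over sets of positive measure;
    on null sets the inequality is trivial. *)
Lemma conductance_iso (c : R) A : 0 <= c -> (c%:E <= conductance K pi)%E ->
  measurable A -> fine (pi A) <= 2^-1 ->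
  c * fine (pi A) <= ip pi \1_A (mop K \1_(~` A)).
Proof.
move=> c0 cphi mA A2; have mAC := measurableC mA.
have pA : pi A = (fine (pi A))%:E by rewrite fineK// fin_num_measure.
have [A0|A0] := eqVneq (fine (pi A)) 0.
  rewrite A0 mulr0; apply: Rint_ge0 => x; apply: mulr_ge0 => //.
  by apply: mop_ge0.
have {}A0 : 0 < fine (pi A) by rewrite lt0r A0/= fine_ge0.
rewrite -lee_fin ip_indic// EFinM -lee_pdivlMr//.
  apply: (le_trans cphi); apply: ereal_inf_lbound; exists A => /=.
    by rewrite pA lte_fin lee_fin A0.
  by rewrite pA inver gt_eqF.
Qed.

End isoperimetry.

(** * The error bound *)

Section error.
Context d (Omega : measurableType d) (R : realType).
Context d' (T : measurableType d') (P : probability T R).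
Variables (K : R.-pker Omega ~> Omega) (pi nu : probability Omega R).
Variable X : nat -> {RV P >-> Omega}.
Hypothesis mkX : markov_chain nu K X.
Hypothesis rev : reversible K pi.
Variable r : Omega -> R.
Hypothesis br : bmeas r.
Hypothesis nur : forall h, bmeas h -> \int[nu]_x h x = ip pi r h.
Let P1 : P setT = 1%E. Proof. exact: probability_setT. Qed.
Let pi1 : pi setT = 1%E. Proof. exact: probability_setT. Qed.

(** The law of X_j is dominated by pi: its value on a pi-null set N is
    <1_N, P^j r>, and 1_N vanishes in L2(pi). *)
Lemma chain_ae (Q : Omega -> Prop) j :
  {ae pi, forall x, Q x} -> {ae P, forall w, Q (X j w)}.
Proof.
move=> [N [mN N0 QN]]; exists (X j @^-1` N); split.
- by rewrite -[X in measurable X]setTI; exact: measurable_funP.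
- have b1N := bmeas_indic R mN.
  have bKr := bmeas_iter_mop K j br.
  have : \int[P]_w \1_N (X j w) = 0.
    rewrite (chain_mean mkX)// nur; last exact: bmeas_iter_mop.
    rewrite iter_mop_sym//; apply/eqP; rewrite -normr_le0.
    apply: (le_trans (norm_ip_le pi1 b1N bKr)).
    have -> : nrm pi \1_N = 0; last by rewrite mul0r.
    have -> : nrm pi \1_N = Num.sqrt (\int[pi]_x \1_N x).
      congr Num.sqrt; apply: eq_Rintegral => x _.
      by rewrite indicE; case: (_ \in _); rewrite ?mulr1 ?mulr0.
    rewrite Rint_indic// [X in Num.sqrt X](_ : _ = 0) ?sqrtr0//.
    exact: (congr1 fine N0).
  have mXN : measurable (X j @^-1` N).
    by rewrite -[X in measurable X]setTI; exact: measurable_funP.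
  rewrite (_ : (fun w => _) = \1_(X j @^-1` N)); last first.
    by apply/funext => w; rewrite !indicE.
  rewrite Rint_indic// => PN0.
  by rewrite -(fineK (fin_num_measure P _ mXN)) PN0.
- by move=> w /= nQ; apply: QN.
Qed.

Lemma rmse_sample_meanE (f f' : Omega -> R) (n n0 : nat) : (0 < n)%N ->
  measurable_fun setT f -> bmeas f' -> {ae pi, forall x, f x = f' x} ->
  rmse P (sample_mean X f n n0) (\int[pi]_x f x) =
  (Num.sqrt (\int[P]_w (n%:R^-1 * \sum_(1 <= j < n.+1)
    (f' (X (n0 + j)%N w) - \int[pi]_x f' x)) ^+ 2))%:E.
Proof.
move=> n_gt0 mf bf' ff'.
have mX j : measurable_fun setT (X j) by exact: measurable_funPT.
have -> : \int[pi]_x f x = \int[pi]_x f' x.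
  congr fine; apply: ae_eq_integral => //; try exact/measurable_EFinP.
    exact/measurable_EFinP/bf'.1.
  by apply: filterS ff' => x /= -> _.
set s := \int[pi]_x f' x.
set V := fun w : T => (n%:R^-1 * _) ^+ 2.
have bV : bmeas V.
  apply: bmeasX; apply: bmeasM; first exact: bmeas_cst.
  apply: bmeas_sum => j; apply: bmeasD; last exact: bmeas_cst.
  exact: (bmeas_comp (mX _) bf').
rewrite /rmse unlock.
have -> : (\int[P]_w ((`|sample_mean X f n n0 w - s| ^+ 2)%R)%:E)%E = (\int[P]_w V w)%:E.
  rewrite EFin_Rintegral//; apply: ae_eq_integral => //.
  - apply/measurable_EFinP; apply: measurable_funX.
    apply: measurableT_comp => //; apply: measurable_funB => //.
    apply: measurable_funM => //; apply: measurable_sum => j.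
    exact: (measurableT_comp mf (mX _)).
  - exact/measurable_EFinP/bV.1.
  have : {ae P, forall w j, f (X (n0 + j)%N w) = f' (X (n0 + j)%N w)}.
    by apply/ae_foralln => j; exact: (chain_ae (Q := fun x => f x = f' x)).
  apply: filterS => w fw _ /=; congr (_%:E).
  rewrite real_normK ?num_real// /V /sample_mean; congr (_ ^+ 2).
  rewrite sumrB sumr_const_nat subn1/= mulrBr; congr (_ - _).
    by congr (_ * _); apply: eq_bigr => j _; rewrite fw.
  by rewrite -[s *+ _]mulr_natl mulKf// pnatr_eq0 -lt0n.
rewrite poweR_EFin powR12_sqrt//; apply: Rint_ge0 => w; exact: sqr_ge0.
Qed.

Hypothesis lz : lazy K.
Variables (c M F : R).
Hypotheses (c0 : 0 < c) (cphi : (c%:E <= conductance K pi)%E).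
Hypothesis nrmr : nrm pi (fun x => r x - 1) <= Num.sqrt M.
Variable f : Omega -> R.
Hypotheses (bf : bmeas f) (F0 : 0 <= F) (fF : forall x, `|f x| <= F).

Lemma expR_neg_ge (x : R) n : x <= 1 -> (1 - x) ^+ n <= expR (- (n%:R * x)).
Proof.
move=> x1; rewrite -mulrN expRM_natl; apply: lerXn2r; rewrite ?nnegrE ?expR_ge0//.
  by rewrite subr_ge0.
exact: expR_ge1Dx.
Qed.

(** For c^2 <= 2, apply [mean_square_le] with b = 1 - c^2/2 and bound b^n0 by
    exp(-n0 c^2/2).  For c^2 > 2, Cheeger's inequality and laziness give
    0 <= <g, P g> <= (1 - c^2/2) |g|^2 with a negative factor, so g vanishes in
    L2(pi), and [mean_square_le] applies with b = 0. *)
Lemma mean_square_bound n n0 : (0 < n)%N ->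
  let V := \int[P]_w (n%:R^-1 * \sum_(1 <= j < n.+1)
    (f (X (n0 + j)%N w) - \int[pi]_x f x)) ^+ 2 in
  (2 < c ^+ 2 -> V <= 0) /\
  V <= (2 * Num.sqrt (1 + 24 * Num.sqrt M * expR (- (n0%:R * (c ^+ 2 / 2))))
    / (c * Num.sqrt n%:R) * F) ^+ 2.
Proof.
move=> n_gt0 V; pose s := \int[pi]_x f x; pose g x := f x - s.
have bg : bmeas g by rewrite /g; solve_bmeas.
have g0 : \int[pi]_x g x = 0 by rewrite RintD//; solve_bmeas; rewrite Rint_cst// subrr.
have sF : `|s| <= F by exact: ler_norm_Rint.
have gL x : `|g x| <= 2 * F.
  by rewrite mulr2n mulrDl mul1r (le_trans (ler_normB _ _))// lerD.
have L0 : 0 <= 2 * F by rewrite mulr_ge0.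
have gF : nrm pi g <= F.
  apply: nrm_le => //.
  have -> : ip pi g g = ip pi f f - s ^+ 2.
    rewrite /ip (_ : (fun x => _) = fun x => f x * f x + ((- 2 * s) * f x + s ^+ 2)).
      rewrite !RintD//; solve_bmeas; rewrite RintZ//; solve_bmeas; rewrite Rint_cst//.
      by rewrite -/s; move: (\int[pi]_x (f x * f x)) => u; ring.
    by apply/funext => x; rewrite /g; ring.
  have ff : ip pi f f <= F ^+ 2.
    rewrite (le_trans (ler_norm _))// ler_norm_Rint//; first by solve_bmeas.
    by move=> x; rewrite normrM expr2 ler_pM.
  by rewrite (le_trans _ ff)// gerDl oppr_le0 sqr_ge0.
have iso A := @conductance_iso _ _ _ K pi c A (ltW c0) cphi.
have chg u : bmeas u -> \int[pi]_x u x = 0 ->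
    ip pi u (mop K u) <= (1 - c ^+ 2 / 2) * ip pi u u.
  by move=> bu u0; exact: (cheeger rev c0 iso).
have VE : V = \int[P]_w (n%:R^-1 * \sum_(1 <= j < n.+1) g (X (n0 + j)%N w)) ^+ 2.
  by [].
have G0 := nrm_ge0 pi g; have r0 := nrm_ge0 pi (fun x => r x - 1).
have V0 : 2 < c ^+ 2 -> V <= 0.
  move=> c2; have Gz : nrm pi g = 0.
    have := chg g bg g0; have := ip_mop_ge0 rev lz bg; rewrite -nrm_sqr => Pg0 Pg1.
    have := le_trans Pg0 Pg1; rewrite nmulr_rge0; last by lra.
    by rewrite le_eqVlt sqrf_eq0 ltNge sqr_ge0 orbF => /eqP.
  rewrite VE; have gap0 u : bmeas u -> \int[pi]_x u x = 0 ->
      ip pi u (mop K u) <= 0 * ip pi u u.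
    move=> bu u0; rewrite mul0r (le_trans (chg u bu u0))//.
    by rewrite nmulr_rle0 ?ip_ge0//; lra.
  apply: le_trans (mean_square_le mkX rev lz (lexx 0) ltr01 gap0 br nur bg L0 gL g0 n0 n_gt0) _.
  by rewrite Gz expr0n/= !mulr0 addr0 mulr0.
split=> //.
have [c2|c2] := ltP 2 (c ^+ 2); first by rewrite (le_trans (V0 c2))// sqr_ge0.
have b0 : 0 <= 1 - c ^+ 2 / 2 by lra.
have c2_gt0 : 0 < c ^+ 2 by rewrite exprn_gt0.
have b1 : 1 - c ^+ 2 / 2 < 1 by lra.
have H := mean_square_le mkX rev lz b0 b1 chg br nur bg L0 gL g0 n0 n_gt0.
rewrite VE; apply: (le_trans H).
have n0R : 0 < n%:R :> R by rewrite ltr0n.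
set E := expR _.
have bE : (1 - c ^+ 2 / 2) ^+ n0 <= E by apply: expR_neg_ge; lra.
have E0 : 0 <= E by exact: expR_ge0.
have sM0 : 0 <= Num.sqrt M by exact: sqrtr_ge0.
have sn0 : 0 < Num.sqrt n%:R :> R by rewrite sqrtr_gt0.
have A0 : 0 <= 1 + 24 * Num.sqrt M * E by rewrite addr_ge0// !mulr_ge0.
have -> : (2 * Num.sqrt (1 + 24 * Num.sqrt M * E) / (c * Num.sqrt n%:R) * F) ^+ 2 =
    2 ^+ 2 * (1 + 24 * Num.sqrt M * E) / (c ^+ 2 * n%:R) * F ^+ 2.
  rewrite -{2}(sqr_sqrtr A0) -{2}(sqr_sqrtr (ltW n0R)).
  move: sn0; move: (Num.sqrt (1 + _)) (Num.sqrt n%:R) => u v v0.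
  by field; rewrite !gt_eqF.
have -> : 2 / (1 - (1 - c ^+ 2 / 2)) / n%:R = 4 / (c ^+ 2 * n%:R).
  by field; rewrite !gt_eqF//; lra.
have -> : 2 ^+ 2 * (1 + 24 * Num.sqrt M * E) / (c ^+ 2 * n%:R) * F ^+ 2 =
  4 / (c ^+ 2 * n%:R) * (F ^+ 2 + 24 * (Num.sqrt M * E * F * F)).
  by field; rewrite !gt_eqF.
apply: ler_wpM2l; first by rewrite divr_ge0 ?mulr_ge0 ?sqr_ge0 ?ltW.
apply: lerD; first by rewrite lerXn2r ?nnegrE.
apply: (@le_trans _ _ (Num.sqrt M * E * (2 * F) * F)).
  by rewrite !ler_pM ?mulr_ge0 ?exprn_ge0 ?nrm_ge0.
have : 0 <= Num.sqrt M * E * F * F by rewrite !mulr_ge0.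
have -> : Num.sqrt M * E * (2 * F) * F = 2 * (Num.sqrt M * E * F * F) by ring.
by move: (Num.sqrt M * E * F * F) => u; lra.
Qed.

End error.

Local Open Scope charge_scope.
Local Open Scope ereal_scope.

Theorem theorem8 (R : realType)
    (d : measure_display) (Omega : measurableType d)
    (K : R.-pker Omega ~> Omega) (pi nu : probability Omega R)
    (d' : measure_display) (T : measurableType d') (P : probability T R)
    (X : nat -> {RV P >-> Omega})
    (f : Omega -> R) (n n0 : nat)
    (phi := conductance K pi)
    (dnu_dpi := 'd (charge_of_finite_measure nu) '/d pi) :
  countably_generated Omega ->
  reversible K pi ->
  lazy K ->
  0 < phi ->
  nu `<< pi ->
  'N[pi]_+oo[dnu_dpi] < +oo ->
  markov_chain nu K X ->
  f \in Lfun pi +oo ->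
  (0 < n)%N ->
  rmse P (sample_mean X f n n0) (\int[pi]_x f x)%R
  <= 2%:E * (1 + 24%:E * 'N[pi]_+oo[dnu_dpi] `^ 2^-1
                 * expeR (- (n0%:R%:E * (phi ^+ 2 / 2%:E)))) `^ 2^-1
     / (phi * (Num.sqrt n%:R)%:E)
     * 'N[pi]_+oo[EFin \o f].
Proof.
move=> _ rev lz phi0 nupi Moo mkX fL n_gt0.
have mf : measurable_fun setT f by exact: (set_mem (sub_Lfun_mfun fL)).
have Foo : 'N[pi]_+oo[EFin \o f] < +oo by exact: (set_mem (sub_Lfun_finLfun fL)).
set nf := 'N[pi]_+oo[EFin \o f] in Foo *; set nd := 'N[pi]_+oo[dnu_dpi] in Moo *.
have nfE : nf = (fine nf)%:E by rewrite fineK// ge0_fin_numE// Lnorm_ge0.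
have ndE : nd = (fine nd)%:E by rewrite fineK// ge0_fin_numE// Lnorm_ge0.
have F0 : (0 <= fine nf)%R by rewrite fine_ge0// Lnorm_ge0.
have M0 : (0 <= fine nd)%R by rewrite fine_ge0// Lnorm_ge0.
have [r [br rM nur]] := bounded_density nupi ndE.
have nrmr := density_nrm_le br rM nur.
have [|f' [bf' f'F ff']] := @ae_bounded_clip _ _ _ pi _ _ mf F0.
  have := ae_Lnorm_le pi (EFin \o f); rewrite -/nf nfE; apply: filterS => x.
  by rewrite abse_EFin lee_fin.
rewrite (rmse_sample_meanE mkX rev br nur n0 n_gt0 mf bf' ff').
have bound c c0 cphi := @mean_square_bound _ _ _ _ _ P K pi nu X mkX rev r br nur
  lz c (fine nd) (fine nf) c0 cphi nrmr f' bf' F0 f'F n n0 n_gt0.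
have n0R : (0 < Num.sqrt n%:R :> R)%R by rewrite sqrtr_gt0 ltr0n.
have [phioo|phioo] := eqVneq phi +oo.
  (* The right-hand side is 0 here; any c with c^2 > 2 shows that so is the error. *)
  have [|+ _] := bound 2%R (ltr0Sn _ _).
    by rewrite -/phi phioo leey.
  move=> V0; rewrite ler0_sqrtr; last by apply: V0; lra.
  rewrite mule_ge0 ?Lnorm_ge0// mule_ge0 ?inve_ge0 ?mule_ge0 ?poweR_ge0//.
  exact: ltW.
have phiE : phi = (fine phi)%:E by rewrite fineK// gt0_fin_numE// lt_neqAle phioo leey.
have c0 : (0 < fine phi)%R by rewrite -lte_fin -phiE.
have [|_ V] := bound (fine phi) c0; first by rewrite -phiE.
rewrite phiE ndE nfE.
move: (fine phi) (fine nd) (fine nf) c0 M0 F0 V => c M F c0 M0 F0 V.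
have cE : c%:E ^+ 2 / 2%:E = (c ^+ 2 / 2)%:E.
  by rewrite -EFin_expe inver pnatr_eq0.
have cnE : (c%:E * (Num.sqrt n%:R)%:E)^-1 = ((c * Num.sqrt n%:R)^-1)%:E.
  by rewrite -EFinM inver gt_eqF// mulr_gt0.
have eE : expeR (- (n0%:R%:E * (c ^+ 2 / 2)%:E)) =
  (expR (- (n0%:R * (c ^+ 2 / 2))))%:E by [].
rewrite cE cnE eE poweR_EFin -!EFinM lee_fin (powR12_sqrt M0).
have E0 := @expR_ge0 R (- (n0%:R * (c ^+ 2 / 2))).
rewrite powR12_sqrt; last first.
  by rewrite addr_ge0// mulr_ge0// mulr_ge0// sqrtr_ge0.
have := ler_wsqrtr V; rewrite sqrtr_sqr ger0_norm//.
by rewrite mulr_ge0// divr_ge0 ?mulr_ge0 ?sqrtr_ge0// ltW.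
Qed.
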